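(* Let $\mathcal{P}=\mathcal{T}(V)/(R)$ be a binary operad. (a) There is a morphism of operads $\mathrm{Tri}(\mathcal{P})\to\mathrm{TA}(\mathcal{P})$ from the triplicator of $\mathcal{P}$ to the operad of tri-average $\mathcal{P}$-algebras of weight one, which extends the map $$\eta:\ \binom{\omega}{\dashv}\mapsto\omega\circ(\mathrm{id}\otimes P),\qquad\binom{\omega}{\vdash}\mapsto\omega\circ(P\otimes\mathrm{id}),\qquad\binom{\omega}{\perp}\mapsto\omega,\qquad\omega\in V.$$ (b) Let $A$ be a $\mathcal{P}$-algebra and let $P:A\to A$ be a tri-average operator of weight one. Then the operations $$x\dashv_j y=x\circ_jP(y),\qquad x\vdash_jy=P(x)\circ_jy,\qquad x\perp_jy=x\circ_jy,\qquad x,y\in A,\ \circ_j\in\mathcal{P}(2),$$ make $A$ into a $\mathrm{Tri}(\mathcal{P})$-algebra.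
   Context: Operads and trees. $\mathcal{P}=\mathcal{T}(V)/(R)$ over a field $\mathbf{k}$, where $V=V(2)$ is an $\mathbb{S}_2$-module, $\mathcal{T}(V)$ is the free symmetric operad on $V$, and $(R)$ is the operadic ideal generated by $R$. Fix a linear basis $\mathcal{V}$ of $V$ and one planar representative for each isomorphism class of reduced binary rooted trees, so that $\mathcal{T}(V)$ has a basis of decorated planar trees (vertices decorated by elements of $\mathcal{V}$, leaves by distinct positive integers). $R$ is a set of locally homogeneous elements: each $r\in R$ is a combination $r=\sum_i c_i\tau_i$ of such decorated trees with the same set $\mathrm{Lin}(r)$ of leaf labels. The construction of the triplicator below is regarded as independent of these choices. Triplicator. $\mathrm{Tri}(V)=V\otimes(\mathbf{k}\dashv\oplus\,\mathbf{k}\vdash\oplus\,\mathbf{k}\perp)$; write $\binom{\omega}{u}=\omega\otimes u$, with $\binom{\omega}{\dashv}^{(12)}=\binom{\omega^{(12)}}{\vdash}$, $\binom{\omega}{\vdash}^{(12)}=\binom{\omega^{(12)}}{\dashv}$, $\binom{\omega}{\perp}^{(12)}=\binom{\omega^{(12)}}{\perp}$. For a nonempty set $J$ of leaves of a decorated tree $\tau$, $\mathrm{Tri}_J(\tau)$ is the set of all trees obtained by replacing each $\omega$ lying on the path from the root to some $x\in J$ by $\binom{\omega}{\dashv}$, $\binom{\omega}{\vdash}$ or $\binom{\omega}{\perp}$ according as all such paths turn left, all turn right, or some turn left and some right at that vertex, and each other $\omega$ by any one of $\binom{\omega}{\dashv},\binom{\omega}{\vdash},\binom{\omega}{\perp}$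 (all independent choices). For $r=\sum_ic_i\tau_i$, $\mathrm{Tri}_J(r)=\{\sum_i c_iw_i\mid w_i\in\mathrm{Tri}_J(\tau_i)\}$, and $\mathrm{Tri}(\mathcal{P})=\mathcal{T}(\mathrm{Tri}(V))/(\bigcup_{r\in R}\bigcup_{\varnothing\ne J\subseteq\mathrm{Lin}(r)}\mathrm{Tri}_J(r))$. Average operators. A tri-average operator of weight one on a $\mathbf{k}$-module $A$ with a binary operation $\cdot$ is a $\mathbf{k}$-linear map $P:A\to A$ with $P(x\cdot P(y))=P(x)\cdot P(y)=P(P(x)\cdot y)$ and $P(x)\cdot P(y)=P(x\cdot y)$ for all $x,y\in A$; on a $\mathcal{P}$-algebra these identities are required for every operation in $V$. Let $V_P$ be the $\mathbb{S}$-module with $V_P(1)=\mathbf{k}P$ ($P$ a symbol, a unary operation different from $\mathrm{id}$) and $V_P(2)=V$, and let $\mathcal{T}(V_P)$ be the free operad on it. Put $$\mathrm{TA}_{\mathcal{P}}=\{\omega\circ(P\otimes P)-P\circ\omega\circ(P\otimes\mathrm{id}),\ \omega\circ(P\otimes P)-P\circ\omega\circ(\mathrm{id}\otimes P),\ \omega\circ(P\otimes P)-P\circ\omega\mid\omega\in V\}.$$ The operad of tri-average $\mathcal{P}$-algebras of weight one is $\mathrm{TA}(\mathcal{P})=\mathcal{T}(V_P)/(R,\mathrm{TA}_{\mathcal{P}})$. *)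

(* Defs.v *)
From Stdlib Require List.
From HB Require Import structures.
From mathcomp Require Import all_boot all_order all_algebra.
From mathcomp Require Import generic_quotient finmap.
From mathcomp Require Import boolp.

Set Implicit Arguments.
Unset Strict Implicit.
Unset Printing Implicit Defensive.

Import GRing.Theory.
Local Open Scope ring_scope.
Local Open Scope quotient_scope.

(** * Finite sets and bijections

   The sets are taken in [Set]: terms over the generators of an operad are
   indexed by them, and that index type has to be small for the terms modulo
   relations to carry a [lmodType] structure. *)

Record FSet := MkFSet {
  carrier : Set;
  finP : exists s : seq carrier, forall x, List.In x s
}.
#[reversible] Coercion carrier : FSet >-> Sortclass.

Lemma void_fin : exists s : seq void, forall x, List.In x s.
Proof. by exists [::] => -[]. Qed.
Canonical void_FSet := MkFSet void_fin.

Lemma unit_fin : exists s : seq unit, forall x, List.In x s.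
Proof. by exists [:: tt] => -[]; left. Qed.
Canonical unit_FSet := MkFSet unit_fin.

Lemma bool_fin : exists s : seq bool, forall x, List.In x s.
Proof. by exists [:: true; false] => -[]; [left|right; left]. Qed.
Canonical bool_FSet := MkFSet bool_fin.

Lemma option_fin (A : FSet) : exists s : seq (option A), forall x, List.In x s.
Proof.
case: (finP A) => s sP; exists (None :: map Some s) => -[x|]; last by left.
by right; apply: List.in_map.
Qed.
Canonical option_FSet (A : FSet) := MkFSet (option_fin A).

Lemma sum_fin (A B : FSet) : exists s : seq (A + B), forall x, List.In x s.
Proof.
case: (finP A) (finP B) => s sP [t tP].
exists (map inl s ++ map inr t) => -[x|x]; apply/List.in_or_app;
  [left|right]; exact: List.in_map.
Qed.
Canonical sum_FSet (A B : FSet) := MkFSet (sum_fin A B).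

Record bij (A B : FSet) := Bij { bfun :> A -> B; bijP : bijective bfun }.

Definition mkbij (A B : FSet) (f : A -> B) (g : B -> A)
  (fK : cancel f g) (gK : cancel g f) : bij A B := Bij (Bijective fK gK).

Lemma bij_ext (A B : FSet) (f g : bij A B) : f =1 g -> f = g.
Proof.
case: f g => [f fb] [g gb] /= /funext fg; rewrite fg in fb *.
by congr Bij; exact: Prop_irrelevance.
Qed.

Definition bij_id (A : FSet) : bij A A :=
  mkbij (f := id) (g := id) (fun=> erefl) (fun=> erefl).

Definition bij_cmp (A B C : FSet) (g : bij B C) (f : bij A B) : bij A C :=
  Bij (bij_comp (bijP g) (bijP f)).

Section Isos.
Variables A B C : FSet.

Lemma omap_bij (A' : FSet) (f : bij A A') : bijective (omap f).
Proof.
by case: (bijP f) => g fK gK; exists (omap g) => -[x|] //=; rewrite ?fK ?gK.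
Qed.
Definition bij_option (A' : FSet) (f : bij A A') : bij (option A) (option A')
  := Bij (omap_bij f).

Definition sum_map (A' B' : Type) (f : A -> A') (g : B -> B') (x : A + B) :
    A' + B' :=
  match x with inl a => inl (f a) | inr b => inr (g b) end.
Lemma sum_map_bij (A' B' : FSet) (f : bij A A') (g : bij B B') :
  bijective (sum_map f g).
Proof.
case: (bijP f) (bijP g) => f' fK f'K [g' gK g'K].
exists (fun x : A' + B' =>
  match x with inl a => inl (f' a) | inr b => inr (g' b) end);
  by move=> [x|x] /=; rewrite ?fK ?f'K ?gK ?g'K.
Qed.
Definition bij_sum (A' B' : FSet) (f : bij A A') (g : bij B B') :
  bij (A + B)%type (A' + B')%type := Bij (sum_map_bij f g).

Definition bij_sum_option : bij (A + option B)%type (option (A + B)%type).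
Proof.
exists (fun x => match x with
  | inl a => Some (inl a) | inr (Some b) => Some (inr b) | inr None => None
  end).
by exists (fun x => match x with
  | Some (inl a) => inl a | Some (inr b) => inr (Some b) | None => inr None end)
  => [[?|[?|]]|[[?|?]|]].
Defined.

Definition bij_option_sum : bij (option A + B)%type (option (A + B)%type).
Proof.
exists (fun x => match x with
  | inl (Some a) => Some (inl a) | inl None => None | inr b => Some (inr b)
  end).
by exists (fun x => match x with
  | Some (inl a) => inl (Some a) | Some (inr b) => inr b | None => inl None end)
  => [[[?|]|?]|[[?|?]|]].
Defined.

Definition bij_sumA : bij ((A + B) + C)%type (A + (B + C))%type.
Proof.
exists (fun x => match x with
  | inl (inl a) => inl a | inl (inr b) => inr (inl b) | inr c => inr (inr c)
  end).
by exists (fun x => match x with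
  | inl a => inl (inl a) | inr (inl b) => inl (inr b) | inr (inr c) => inr c
  end)
  => [[[?|?]|?]|[?|[?|?]]].
Defined.

Definition bij_sumAC : bij ((A + C) + B)%type ((A + B) + C)%type.
Proof.
exists (fun x => match x with
  | inl (inl a) => inl (inl a) | inl (inr c) => inr c
  | inr b => inl (inr b) end).
by exists (fun x => match x with
  | inl (inl a) => inl (inl a) | inl (inr b) => inr b
  | inr c => inl (inr c) end)
  => [[[?|?]|?]|[[?|?]|?]].
Defined.

Definition bij_option_swap : bij (option (option A)) (option (option A)).
Proof.
pose f (x : option (option A)) := match x with
  | Some (Some a) => Some (Some a) | Some None => None | None => Some None end.
by exists f; exists f => [[[?|]|]|[[?|]|]].
Defined.

Definition bij_sum_unit : bij (A + unit)%type (option A).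
Proof.
exists (fun x => match x with inl a => Some a | inr _ => None end).
by exists (fun x => match x with Some a => inl a | None => inr tt end)
  => [[?|[]]|[?|]].
Defined.

Definition bij_unit_sum : bij (unit + A)%type (option A).
Proof.
exists (fun x => match x with inl _ => None | inr a => Some a end).
by exists (fun x => match x with Some a => inr a | None => inl tt end)
  => [[[]|?]|[?|]].
Defined.

Definition bij_void_sum : bij (void + A)%type A.
Proof.
exists (fun x : (void + A)%type =>
  match x with inl v => match v with end | inr a => a end).
by exists (fun a => inr a) => [[[]|?]|?].
Defined.

End Isos.

Definition bij_unit_void : bij unit (option void).
Proof.
exists (fun _ => None); exists (fun _ => tt); first by case.
by case=> // -[].
Defined.

Definition bij_bool_option : bij bool (option unit).
Proof.
exists (fun b => if b then Some tt else None).
by exists (fun o => if o is Some _ then true else false) => [[]|[[]|]].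
Defined.

Definition bij_unit2_bool : bij (unit + unit)%type bool.
Proof.
exists (fun x => if x is inr _ then true else false).
by exists (fun b : bool => if b then inr tt else inl tt) => [[[]|[]]|[]].
Defined.

Definition bij_negb : bij bool bool := mkbij negbK negbK.

(** * Symmetric operads

   An operad is given here in its coordinate-free form: a functor from the
   groupoid of finite sets (of inputs) and bijections to k-modules, with
   partial compositions.  [P(n)] with its action of the symmetric group is
   [P 'I_n]; [comp x y] plugs [y] into the distinguished input [None] of [x]. *)

Section Operads.
Variable k : fieldType.

Record operad := Operad {
  ob :> FSet -> lmodType k;
  relab : forall A B : FSet, bij A B -> ob A -> ob B;
  op_id : ob unit;
  pcomp : forall A B : FSet, ob (option A) -> ob B -> ob (A + B)%type;
  relab_linear : forall (A B : FSet) (f : bij A B), linear (relab f);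
  comp_linearl : forall (A B : FSet) (y : ob B),
    linear (fun x => @pcomp A B x y);
  comp_linearr : forall (A B : FSet) (x : ob (option A)),
    linear (fun y => @pcomp A B x y);
  relab_id : forall (A : FSet) (x : ob A), relab (bij_id A) x = x;
  relab_comp : forall (A B C : FSet) (g : bij B C) (f : bij A B) (x : ob A),
    relab (bij_cmp g f) x = relab g (relab f x);
  comp_relab : forall (A A' B B' : FSet) (f : bij A A') (g : bij B B')
      (x : ob (option A)) (y : ob B),
    pcomp (relab (bij_option f) x) (relab g y)
    = relab (bij_sum f g) (pcomp x y);
  comp_idr : forall (A : FSet) (x : ob (option A)),
    relab (bij_sum_unit A) (pcomp x op_id) = x;
  comp_idl : forall (A : FSet) (x : ob A),
    relab (bij_void_sum A) (pcomp (relab bij_unit_void op_id) x) = x;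
  comp_seq : forall (A B C : FSet)
      (x : ob (option A)) (y : ob (option B)) (z : ob C),
    relab (bij_sumA A B C) (pcomp (relab (bij_sum_option A B) (pcomp x y)) z)
    = pcomp x (pcomp y z);
  comp_par : forall (A B C : FSet)
      (x : ob (option (option A))) (y : ob B) (z : ob C),
    pcomp (relab (bij_option_sum A B) (pcomp x y)) z
    = relab (bij_sumAC A B C)
        (pcomp (relab (bij_option_sum A C)
                 (pcomp (relab (bij_option_swap A) x) z))
              y)
}.

Arguments op_id {o}.

Record operad_morphism (P Q : operad) := OperadMorphism {
  omor : forall A : FSet, P A -> Q A;
  omor_linear : forall (A : FSet), linear (@omor A);
  omor_relab : forall (A B : FSet) (f : bij A B) (x : P A),
    omor (relab f x) = relab f (omor x);
  omor_id : omor op_id = op_id;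
  omor_comp : forall (A B : FSet) (x : P (option A)) (y : P B),
    omor (pcomp x y) = pcomp (omor x) (omor y)
}.

Record algebra (P : operad) (M : lmodType k) := Algebra {
  alg_act : forall A : FSet, P A -> (A -> M) -> M;
  alg_act_linear : forall (A : FSet) (a : A -> M) (c : k) (x y : P A),
    alg_act (c *: x + y) a = c *: alg_act x a + alg_act y a;
  alg_act_multilinear : forall (A : FSet) (x : P A) (i : A) (c : k)
      (a b d : A -> M),
    (forall j : A, j <> i -> a j = d j /\ b j = d j) ->
    d i = c *: a i + b i ->
    alg_act x d = c *: alg_act x a + alg_act x b;
  alg_act_relab : forall (A B : FSet) (f : bij A B) (x : P A) (a : B -> M),
    alg_act (relab f x) a = alg_act x (a \o f);
  alg_act_id : forall a : unit -> M, alg_act op_id a = a tt;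
  alg_act_comp : forall (A B : FSet) (x : P (option A)) (y : P B)
      (a : (A + B)%type -> M),
    alg_act (pcomp x y) a
    = alg_act x
        (fun o => if o is Some i then a (inl i) else alg_act y (a \o inr))
}.

(* In a binary operation the first input is [false], the second is [true]. *)
Definition act2 (P : operad) (M : lmodType k) (rho : algebra P M) (w : P bool)
  (x y : M) : M := alg_act rho w (fun b => if b then y else x).

(* [comp2 w x y] is [w o (x (x) y)] and [comp1 p x] is [p o x]. *)
Definition comp2 (P : operad) (A B : FSet) (w : P bool) (x : P A) (y : P B) :
    P (A + B)%type :=
  pcomp (relab (bij_unit_sum A) (pcomp (relab bij_bool_option w) x)) y.

Definition comp1 (P : operad) (A : FSet) (p : P unit) (x : P A) : P A :=
  relab (bij_void_sum A) (pcomp (relab bij_unit_void p) x).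

(* [w o (x (x) y)] for unary [x] and [y], as a binary operation. *)
Definition comp11 (P : operad) (w : P bool) (x y : P unit) : P bool :=
  relab bij_unit2_bool (comp2 w x y).

(** * Ideals and quotients *)

Record ideal (P : operad) := Ideal {
  in_ideal :> forall A : FSet, P A -> Prop;
  ideal0 : forall A : FSet, @in_ideal A 0;
  idealP : forall (A : FSet) (c : k) (x y : P A),
    in_ideal x -> in_ideal y -> in_ideal (c *: x + y);
  ideal_relab : forall (A B : FSet) (f : bij A B) (x : P A),
    in_ideal x -> in_ideal (relab f x);
  ideal_compl : forall (A B : FSet) (x : P (option A)) (y : P B),
    in_ideal x -> in_ideal (pcomp x y);
  ideal_compr : forall (A B : FSet) (x : P (option A)) (y : P B),
    in_ideal y -> in_ideal (pcomp x y)
}.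

Definition opset (P : operad) := forall A : FSet, P A -> Prop.

Section GeneratedIdeal.
Variables (P : operad) (G : opset P).

Definition in_generated (A : FSet) (x : P A) : Prop :=
  forall I : ideal P, (forall (B : FSet) (y : P B), G y -> I B y) -> I A x.

Definition generated_ideal : ideal P.
Proof.
refine (@Ideal P in_generated _ _ _ _ _).
- by move=> A I _; exact: ideal0.
- by move=> A c x y hx hy I hI; apply: idealP; [exact: hx|exact: hy].
- by move=> A B f x hx I hI; apply: ideal_relab; exact: hx.
- by move=> A B x y hx I hI; apply: ideal_compl; exact: hx.
- by move=> A B x y hx I hI; apply: ideal_compr; exact: hx.
Defined.

End GeneratedIdeal.

Section Quotient.
Variables (P : operad) (I : ideal P).

Section Module.
Variable A : FSet.

Let idealN (x : P A) : I A x -> I A (- x).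
Proof.
by move=> hx; rewrite -scaleN1r -[X in I A X]addr0; apply: idealP => //;
  exact: ideal0.
Qed.

Let idealD (x y : P A) : I A x -> I A y -> I A (x + y).
Proof. by move=> hx hy; rewrite -[x]scale1r; exact: idealP. Qed.

Definition quo_rel (x y : P A) : bool := `[< I A (x - y) >].

Lemma quo_relP : equiv_class_of quo_rel.
Proof.
split.
- by move=> x; apply/asboolP; rewrite subrr; exact: ideal0.
- move=> x y; apply/asboolP/asboolP => h; rewrite -opprB; exact: idealN.
- move=> y x z /asboolP h /asboolP h'; apply/asboolP.
  by rewrite -(subrKA y); exact: idealD.
Qed.

Canonical quo_equiv := EquivRelPack quo_relP.

Definition quo := {eq_quot quo_equiv}.
HB.instance Definition _ := Choice.on quo.
HB.instance Definition _ := EqQuotient.on quo.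

Definition cls (x : P A) : quo := \pi_quo x.

Lemma clsP (x y : P A) : cls x = cls y <-> I A (x - y).
Proof.
split; first by move=> /eqquotP /asboolP.
by move=> h; apply/eqquotP/asboolP.
Qed.

Lemma cls_surj (q : quo) : exists x, q = cls x.
Proof. by exists (repr q); rewrite /cls reprK. Qed.

Lemma cls_repr (x : P A) : I A (repr (cls x) - x).
Proof. by apply/clsP; rewrite /cls reprK. Qed.

Definition quo_add (p q : quo) := cls (repr p + repr q).
Definition quo_opp (p : quo) := cls (- repr p).
Definition quo_scale (c : k) (p : quo) := cls (c *: repr p).


Let addE x y : quo_add (cls x) (cls y) = cls (x + y).
Proof.
by apply/clsP; rewrite opprD addrACA; apply: idealD; exact: cls_repr.
Qed.

Let oppE x : quo_opp (cls x) = cls (- x).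
Proof. by apply/clsP; rewrite -opprD; apply: idealN; exact: cls_repr. Qed.

Let scaleE c x : quo_scale c (cls x) = cls (c *: x).
Proof.
apply/clsP; rewrite -scalerBr -[_ *: _]addr0.
by apply: idealP; [exact: cls_repr|exact: ideal0].
Qed.

Ltac quo_lift := repeat (let q := fresh "q" in intro q;
  match type of q with quo => case: (cls_surj q) => ? -> | _ => idtac end);
  do 3?rewrite ?(addE, oppE, scaleE).

Let quo_addA : associative quo_add.
Proof. by quo_lift; rewrite addrA. Qed.
Let quo_addC : commutative quo_add.
Proof. by quo_lift; rewrite addrC. Qed.
Let quo_add0 : left_id (cls 0) quo_add.
Proof. by quo_lift; rewrite add0r. Qed.
Let quo_addN : left_inverse (cls 0) quo_opp quo_add.
Proof. by quo_lift; rewrite addNr. Qed.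

HB.instance Definition _ :=
  GRing.isZmodule.Build quo quo_addA quo_addC quo_add0 quo_addN.

Let quo_scaleA a b v : quo_scale a (quo_scale b v) = quo_scale (a * b) v.
Proof. by move: v; quo_lift; rewrite scalerA. Qed.
Let quo_scale1 : left_id 1 quo_scale.
Proof. by quo_lift; rewrite scale1r. Qed.
Let quo_scaleDr : right_distributive quo_scale quo_add.
Proof. by quo_lift; rewrite scalerDr. Qed.
Let quo_scaleDl v :
  {morph quo_scale^~ v : a b / a + b >-> quo_add a b}.
Proof. by move: v; quo_lift; rewrite scalerDl. Qed.

HB.instance Definition _ :=
  GRing.Zmodule_isLmodule.Build k quo quo_scaleA quo_scale1 quo_scaleDr
    quo_scaleDl.

Lemma cls_linear : linear cls.
Proof.
by move=> c x y; rewrite -[_ *: cls x]/(quo_scale _ _) scaleE; exact/esym/addE.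
Qed.

End Module.

Let cls_eq (A : FSet) (x y : P A) : I A (x - y) -> cls x = cls y.
Proof. by move=> h; apply/clsP. Qed.

Definition quo_relab (A B : FSet) (f : bij A B) (q : quo A) : quo B :=
  cls (relab f (repr q)).
Definition quo_comp (A B : FSet) (p : quo (option A)) (q : quo B) :
  quo (A + B)%type := cls (pcomp (repr p) (repr q)).

Lemma linB (U W : lmodType k) (f : U -> W) (x y : U) :
  linear f -> f (x - y) = f x - f y.
Proof.
by move=> lf; rewrite -[x - y]addrC -scaleN1r lf scaleN1r addrC.
Qed.

Lemma quo_relabE (A B : FSet) (f : bij A B) (x : P A) :
  quo_relab f (cls x) = cls (relab f x).
Proof.
apply: cls_eq; rewrite -(linB _ _ (@relab_linear P A B f)).
by apply: ideal_relab; exact: cls_repr.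
Qed.

Lemma quo_compE (A B : FSet) (x : P (option A)) (y : P B) :
  quo_comp (cls x) (cls y) = cls (pcomp x y).
Proof.
transitivity (cls (pcomp x (repr (cls y)))); apply: cls_eq.
  rewrite -(linB _ _ (@comp_linearl P A B _)).
  by apply: ideal_compl; exact: cls_repr.
rewrite -(linB _ _ (@comp_linearr P A B _)).
by apply: ideal_compr; exact: cls_repr.
Qed.

Let quoE := (quo_relabE, quo_compE).

Definition quotient_operad : operad.
Proof.
refine (@Operad (fun A => quo A : lmodType k) quo_relab (cls op_id) quo_comp
  _ _ _ _ _ _ _ _ _ _) => /=.
- move=> A B f c x y; case: (cls_surj x) (cls_surj y) => x' -> [y' ->].
  by rewrite -cls_linear !quoE -cls_linear relab_linear.
- move=> A B z c x y; case: (cls_surj x) (cls_surj y) => x' -> [y' ->].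
  by case: (cls_surj z) => z' ->; rewrite -cls_linear !quoE -cls_linear
    comp_linearl.
- move=> A B z c x y; case: (cls_surj x) (cls_surj y) => x' -> [y' ->].
  by case: (cls_surj z) => z' ->; rewrite -cls_linear !quoE -cls_linear
    comp_linearr.
- by move=> A x; case: (cls_surj x) => x' ->; rewrite quoE relab_id.
- by move=> A B C g f x; case: (cls_surj x) => x' ->;
  rewrite [quo_relab f _]quo_relabE
    !quo_relabE relab_comp.
- move=> A A' B B' f g x y; case: (cls_surj x) (cls_surj y) => x' -> [y' ->].
  by rewrite 2!quo_relabE
    2!quo_compE quo_relabE comp_relab.
- by move=> A x; case: (cls_surj x) => x' ->; rewrite quo_compE quo_relabE
    comp_idr.
- by move=> A x; case: (cls_surj x) => x' ->;
  rewrite [quo_relab bij_unit_void _]quo_relabE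
    quo_compE quo_relabE comp_idl.
- move=> A B C x y z; case: (cls_surj x) (cls_surj y) => x' -> [y' ->].
  by case: (cls_surj z) => z' ->; rewrite [quo_comp (cls x') (cls y')]quo_compE
    [quo_relab (bij_sum_option _ _) _]quo_relabE [quo_comp (cls y') _]quo_compE
    !quo_compE quo_relabE comp_seq.
- move=> A B C x y z; case: (cls_surj x) (cls_surj y) => x' -> [y' ->].
  by case: (cls_surj z) => z' ->; rewrite [quo_comp (cls x') (cls y')]quo_compE
    [quo_relab (bij_option_sum _ _) (cls _)]quo_relabE
    [quo_relab (bij_option_swap _) _]quo_relabE
    [quo_comp (cls _) (cls z') in RHS]quo_compE
    [quo_relab (bij_option_sum _ _) (cls _)]quo_relabE !quo_compE quo_relabE
    comp_par.
Defined.

Definition quo_proj : operad_morphism P quotient_operad.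
Proof.
refine (@OperadMorphism P quotient_operad cls cls_linear _ _ _).
- by move=> A B f x; rewrite /= quoE.
- by [].
- by move=> A B x y; rewrite /= quoE.
Defined.

End Quotient.

(** * Free operads on S-modules concentrated in arities 1 and 2 *)

Record s2module := S2Module {
  s2mod :> lmodType k;
  s2act : s2mod -> s2mod;
  s2act_linear : linear s2act;
  s2actK : involutive s2act
}.

Record smodule12 := SModule12 { arity1 : lmodType k; arity2 : s2module }.

Record interp (E : smodule12) (P : operad) := Interp {
  interp1 : arity1 E -> P unit;
  interp2 : arity2 E -> P bool;
  interp1_linear : linear interp1;
  interp2_linear : linear interp2;
  interp2_act : forall v, interp2 (s2act v) = relab bij_negb (interp2 v)
}.

Section Free.
Variable E : smodule12.

Inductive term : FSet -> Type :=
| Tzero (A : FSet) : term A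
| Tadd (A : FSet) : term A -> term A -> term A
| Tscale (A : FSet) : k -> term A -> term A
| Tgen1 : arity1 E -> term unit
| Tgen2 : arity2 E -> term bool
| Tid : term unit
| Trelab (A B : FSet) : bij A B -> term A -> term B
| Tcomp (A B : FSet) : term (option A) -> term B -> term (A + B)%type.

Fixpoint term_eval (P : operad) (g : interp E P) (A : FSet) (t : term A) :
    P A :=
  match t in term A return P A with
  | Tzero A => 0
  | Tadd A t u => term_eval g t + term_eval g u
  | Tscale A c t => c *: term_eval g t
  | Tgen1 v => interp1 g v
  | Tgen2 v => interp2 g v
  | Tid => op_id
  | Trelab A B f t => relab f (term_eval g t)
  | Tcomp A B t u => pcomp (term_eval g t) (term_eval g u)
  end.


Section Module.
Variable A : FSet.

HB.instance Definition _ := gen_eqMixin (term A).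
HB.instance Definition _ := gen_choiceMixin (term A).

(* Two terms are identified when they agree in every operad, whatever the
   interpretation of the generators; see [free_lift_unique]. *)
Definition term_rel (t u : term A) : bool :=
  `[< forall (P : operad) (g : interp E P), term_eval g t = term_eval g u >].

Lemma term_relP : equiv_class_of term_rel.
Proof.
split.
- by move=> t; apply/asboolP.
- by move=> t u; apply/asboolP/asboolP => h P g; rewrite h.
- move=> u t v /asboolP h /asboolP h'; apply/asboolP => P g.
  by rewrite h h'.
Qed.

Canonical term_equiv := EquivRelPack term_relP.

Definition freeop := {eq_quot term_equiv}.
HB.instance Definition _ := Choice.on freeop.
HB.instance Definition _ := EqQuotient.on freeop.

Definition tcls (t : term A) : freeop := \pi_freeop t.

Definition free_eval (P : operad) (g : interp E P) (x : freeop) : P A :=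
  term_eval g (repr x).

Lemma free_eval_tcls (P : operad) (g : interp E P) (t : term A) :
  free_eval g (tcls t) = term_eval g t.
Proof.
suff /eqquotP /asboolP : repr (tcls t) = t %[mod freeop] by exact.
by rewrite /tcls reprK.
Qed.

Lemma free_ext (x y : freeop) :
  (forall (P : operad) (g : interp E P), free_eval g x = free_eval g y) ->
  x = y.
Proof.
move=> h; rewrite -[x]reprK -[y]reprK.
by apply/eqquotP/asboolP => P g; exact: h.
Qed.

Definition free_zero := tcls (Tzero A).
Definition free_add (x y : freeop) := tcls (Tadd (repr x) (repr y)).
Definition free_opp (x : freeop) := tcls (Tscale (-1) (repr x)).
Definition free_scale (c : k) (x : freeop) := tcls (Tscale c (repr x)).

Let lift0 (P : operad) (g : interp E P) : free_eval g free_zero = 0.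
Proof. by rewrite free_eval_tcls. Qed.
Let liftD (P : operad) (g : interp E P) x y :
  free_eval g (free_add x y) = free_eval g x + free_eval g y.
Proof. by rewrite free_eval_tcls. Qed.
Let liftN (P : operad) (g : interp E P) x :
  free_eval g (free_opp x) = - free_eval g x.
Proof. by rewrite free_eval_tcls /= scaleN1r. Qed.
Let liftZ (P : operad) (g : interp E P) c x :
  free_eval g (free_scale c x) = c *: free_eval g x.
Proof. by rewrite free_eval_tcls. Qed.
Let liftE := (lift0, liftD, liftN, liftZ).

Let free_addA : associative free_add.
Proof. by move=> x y z; apply: free_ext => P g; rewrite !liftE addrA. Qed.
Let free_addC : commutative free_add.
Proof. by move=> x y; apply: free_ext => P g; rewrite !liftE addrC. Qed.
Let free_add0 : left_id free_zero free_add.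
Proof. by move=> x; apply: free_ext => P g; rewrite !liftE add0r. Qed.
Let free_addN : left_inverse free_zero free_opp free_add.
Proof. by move=> x; apply: free_ext => P g; rewrite !liftE addNr. Qed.

HB.instance Definition _ :=
  GRing.isZmodule.Build freeop free_addA free_addC free_add0 free_addN.

Let free_scaleA a b v : free_scale a (free_scale b v) = free_scale (a * b) v.
Proof. by apply: free_ext => P g; rewrite !liftE scalerA. Qed.
Let free_scale1 : left_id 1 free_scale.
Proof. by move=> x; apply: free_ext => P g; rewrite !liftE scale1r. Qed.
Let free_scaleDr : right_distributive free_scale free_add.
Proof. by move=> c x y; apply: free_ext => P g; rewrite !liftE scalerDr. Qed.
Let free_scaleDl v : {morph free_scale^~ v : a b / a + b >-> free_add a b}.
Proof. by move=> c x; apply: free_ext => P g; rewrite !liftE scalerDl. Qed.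

HB.instance Definition _ :=
  GRing.Zmodule_isLmodule.Build k freeop free_scaleA free_scale1 free_scaleDr
    free_scaleDl.

Lemma free_eval_linear (P : operad) (g : interp E P) : linear (free_eval g).
Proof.
move=> c x y; rewrite -[c *: x]/(free_scale c x).
by rewrite -[_ + y]/(free_add _ y) !liftE.
Qed.

End Module.

Definition free_id : freeop unit := tcls Tid.
Definition free_relab (A B : FSet) (f : bij A B) (x : freeop A) : freeop B :=
  tcls (Trelab f (repr x)).
Definition free_comp (A B : FSet) (x : freeop (option A)) (y : freeop B) :
  freeop (A + B)%type := tcls (Tcomp (repr x) (repr y)).

Lemma free_eval_id (P : operad) (g : interp E P) : free_eval g free_id = op_id.
Proof. exact: free_eval_tcls. Qed.
Lemma free_eval_relab (P : operad) (g : interp E P) (A B : FSet) (f : bij A B)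
  (x : freeop A) : free_eval g (free_relab f x) = relab f (free_eval g x).
Proof. exact: free_eval_tcls. Qed.
Lemma free_eval_comp (P : operad) (g : interp E P) (A B : FSet)
  (x : freeop (option A)) (y : freeop B) :
  free_eval g (free_comp x y) = pcomp (free_eval g x) (free_eval g y).
Proof. exact: free_eval_tcls. Qed.

Definition free_operad : operad.
Proof.
refine (@Operad (fun A => freeop A : lmodType k) free_relab free_id free_comp
  _ _ _ _ _ _ _ _ _ _) => /=; [move=> A B f c x y|move=> A B z c x y
  |move=> A B z c x y|..] => *; apply: free_ext => P g;
  rewrite ?(free_eval_linear, free_eval_relab, free_eval_comp, free_eval_id).
- exact: relab_linear.
- exact: comp_linearl.
- exact: comp_linearr.
- exact: relab_id.
- exact: relab_comp.
- exact: comp_relab.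
- exact: comp_idr.
- exact: comp_idl.
- exact: comp_seq.
- exact: comp_par.
Defined.

Definition gens : interp E free_operad.
Proof.
refine (@Interp E free_operad
  (fun v => tcls (Tgen1 v)) (fun v => tcls (Tgen2 v))
  _ _ _) => [c x y|c x y|v]; apply: free_ext => P g.
- by rewrite free_eval_linear !free_eval_tcls /= interp1_linear.
- by rewrite free_eval_linear !free_eval_tcls /= interp2_linear.
- by rewrite free_eval_relab !free_eval_tcls /= interp2_act.
Defined.

(* Universal property: morphisms out of [free_operad] are interpretations of the
   generators. *)
Definition free_lift (P : operad) (g : interp E P) :
    operad_morphism free_operad P :=
  @OperadMorphism free_operad P (fun A x => free_eval g x)
    (fun A => @free_eval_linear A P g)
    (fun A B => @free_eval_relab P g A B) (free_eval_id g)
    (fun A B => @free_eval_comp P g A B).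

Lemma free_lift_gen1 (P : operad) (g : interp E P) (v : arity1 E) :
  omor (free_lift g) (interp1 gens v) = interp1 g v.
Proof. exact: free_eval_tcls. Qed.

Lemma free_lift_gen2 (P : operad) (g : interp E P) (v : arity2 E) :
  omor (free_lift g) (interp2 gens v) = interp2 g v.
Proof. exact: free_eval_tcls. Qed.

Lemma free_lift_unique (P : operad) (g : interp E P)
    (h : operad_morphism free_operad P) :
  (forall v, omor h (interp1 gens v) = interp1 g v) ->
  (forall v, omor h (interp2 gens v) = interp2 g v) ->
  forall (A : FSet) (x : free_operad A), omor h x = omor (free_lift g) x.
Proof.
move=> h1 h2 A x.
suff H (t : term A) : omor h (tcls t) = term_eval g t.
  by have := H (repr x); rewrite /tcls reprK.
have h0 B : omor h (0 : free_operad B) = 0.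
  rewrite -[0](subrr (0 : free_operad B)) (linB _ _ (@omor_linear _ _ h B)).
  exact: subrr.
have tE (B : FSet) (x1 x2 : free_operad B) :
    (forall (Q : operad) (e : interp E Q), free_eval e x1 = free_eval e x2) ->
    x1 = x2.
  exact: free_ext.
elim: t => {A x} /=.
- by move=> A; rewrite -[RHS](h0 A).
- move=> A t Ht u Hu.
  rewrite -Ht -Hu -[omor h (tcls t)]scale1r -omor_linear; apply: congr1.
  by apply: tE => Q e; rewrite free_eval_linear !free_eval_tcls scale1r.
- move=> A c t Ht.
  rewrite -Ht -[RHS]addr0 -(h0 A) -omor_linear; apply: congr1.
  apply: tE => Q e; rewrite free_eval_linear (_ : free_eval e 0 = 0).
    by rewrite !free_eval_tcls addr0.
  exact: free_eval_tcls.
- by move=> v; rewrite -h1.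
- by move=> v; rewrite -h2.
- exact: omor_id.
- move=> A B f t Ht; rewrite -Ht -omor_relab; apply: congr1.
  by apply: tE => Q e; rewrite free_eval_relab !free_eval_tcls.
- move=> A B t Ht u Hu; rewrite -Ht -Hu -omor_comp; apply: congr1.
  by apply: tE => Q e; rewrite free_eval_comp !free_eval_tcls.
Qed.

End Free.

(** * Decorated planar binary trees *)

Inductive btree (D : Type) : Type :=
| Leaf of nat
| Node of D & btree D & btree D.
Arguments Leaf {D}.

HB.instance Definition _ (D : Type) := gen_eqMixin (btree D).

Section Trees.
Variable D : Type.
Implicit Type t : btree D.

Fixpoint leaves t : seq nat :=
  match t with Leaf i => [:: i] | Node _ l r => leaves l ++ leaves r end.

Definition leafset t : {fset nat} := [fset i in leaves t]%fset.

Definition well_labelled t : bool := uniq (leaves t) && (0%N \notin leaves t).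

Fixpoint tree_shape t : btree unit :=
  match t with
  | Leaf i => Leaf i
  | Node _ l r => Node tt (tree_shape l) (tree_shape r)
  end.

Fixpoint decorated_in (B : D -> Prop) t : Prop :=
  match t with
  | Leaf _ => True
  | Node w l r => [/\ B w, decorated_in B l & decorated_in B r]
  end.

(* The leaves of [t] seen as positions, so that a tree is an operation whose
   inputs are its leaves, whatever their labels. *)
Fixpoint leafpos t : FSet :=
  match t with
  | Leaf _ => unit
  | Node _ l r => (leafpos l + leafpos r)%type
  end.

Fixpoint leaf_label t : leafpos t -> nat :=
  match t return leafpos t -> nat with
  | Leaf i => fun=> i
  | Node _ l r => fun p : (leafpos l + leafpos r)%type =>
      match p with inl p => leaf_label p | inr p => leaf_label p end
  end.

Lemma label_fin (S : {fset nat}) :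
  exists s : seq {i : nat | i \in S}, forall x, List.In x s.
Proof.
exists (pmap insub (enum_fset S)) => x.
suff : x \in pmap insub (enum_fset S).
  elim: (pmap _ _) => //= y s IH; rewrite inE => /orP[/eqP->|/IH];
    by [left|right].
by rewrite mem_pmap_sub; exact: valP.
Qed.
Definition labels (S : {fset nat}) : FSet := MkFSet (label_fin S).

Lemma label_in t (S : {fset nat}) (p : leafpos t) :
  leafset t = S -> leaf_label p \in S.
Proof.
move=> <-; rewrite in_fset /=; elim: t p => [i []|w l IHl r IHr [p|p]] /=.
- exact: mem_head.
- by rewrite mem_cat IHl.
- by rewrite mem_cat IHr orbT.
Qed.

Definition to_labels t (S : {fset nat}) (tS : leafset t = S) (p : leafpos t) :
  labels S := exist _ (leaf_label p) (label_in p tS).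

Lemma label_inj t : uniq (leaves t) -> injective (@leaf_label t).
Proof.
have mem t' (p : leafpos t') : leaf_label p \in leaves t'.
  by have := label_in p erefl; rewrite in_fset.
elim: t => [i _ [] []|w l IHl r IHr /=] //.
rewrite cat_uniq => /and3P[ul /hasPn lr ur].
move=> [p|p] [q|q] /= e; try by congr inl; exact: IHl.
- by have := lr _ (mem _ q); rewrite -e [_ \in _]mem.
- by have := lr _ (mem _ p); rewrite e [_ \in _]mem.
- by congr inr; exact: IHr.
Qed.

Lemma label_surj t i : i \in leaves t -> exists p : leafpos t, leaf_label p = i.
Proof.
elim: t => [j|w l IHl r IHr] /=; first by rewrite inE => /eqP->; exists tt.
rewrite mem_cat => /orP[/IHl|/IHr] [p <-]; first by exists (inl p).
by exists (inr p).
Qed.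

Lemma to_labels_bij t (S : {fset nat}) (tS : leafset t = S) :
  uniq (leaves t) -> bijective (to_labels tS).
Proof.
move=> ut.
have surj (x : labels S) : exists p : leafpos t, to_labels tS p = x.
  case: x => i iS; have : i \in leaves t by move: (iS); rewrite -tS in_fset.
  by case/label_surj => p pi; exists p; exact: val_inj.
pose g x := projT1 (cid (surj x)).
have gK x : to_labels tS (g x) = x by rewrite /g; case: cid.
exists g => // p; apply: (label_inj ut).
by have [] := gK (to_labels tS p).
Qed.

Definition bij_labels t (S : {fset nat}) (tS : uniq (leaves t) /\ leafset t = S)
  : bij (leafpos t) (labels S) := Bij (to_labels_bij (proj2 tS) (proj1 tS)).

Section Evaluation.
Variables (P : operad) (g : D -> P bool).

Fixpoint tree_op t : P (leafpos t) :=
  match t return P (leafpos t) with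
  | Leaf _ => op_id
  | Node w l r => comp2 (g w) (tree_op l) (tree_op r)
  end.

(* The operation of [P], with inputs labelled by [S], given by a tree with leaf
   labels [S]; the value is junk when [S] is not the set of labels of [t]. *)
Definition tree_at (S : {fset nat}) t : P (labels S) :=
  if pselect (uniq (leaves t) /\ leafset t = S) is left tS
  then relab (bij_labels tS) (tree_op t) else 0.

Definition comb_at (S : {fset nat}) (r : seq (k * btree D)) : P (labels S) :=
  \sum_(p <- r) p.1 *: tree_at S p.2.

End Evaluation.
End Trees.

(* Isomorphism of rooted trees with labelled leaves. *)
Inductive tree_iso : btree unit -> btree unit -> Prop :=
| iso_leaf i : tree_iso (Leaf i) (Leaf i)
| iso_node l r l' r' : tree_iso l l' -> tree_iso r r' ->
    tree_iso (Node tt l r) (Node tt l' r')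
| iso_swap l r l' r' : tree_iso l l' -> tree_iso r r' ->
    tree_iso (Node tt l r) (Node tt r' l').

(* A choice of one planar representative in each isomorphism class. *)
Definition planar_representatives (T : btree unit -> Prop) : Prop :=
  (forall t, T t -> well_labelled t) /\
  (forall t, well_labelled t -> exists! t', T t' /\ tree_iso t t').

Definition linear_basis (V : lmodType k) (B : V -> Prop) : Prop :=
  (forall v : V, exists (s : seq V) (c : V -> k),
    (forall w, w \in s -> B w) /\ v = \sum_(w <- s) c w *: w) /\
  (forall (s : seq V) (c : V -> k), uniq s -> (forall w, w \in s -> B w) ->
    \sum_(w <- s) c w *: w = 0 -> forall w, w \in s -> c w = 0).

Section Relations.
Variable V : s2module.

(* [ [:: (c_1, tau_1); ...] ] stands for [sum_i c_i tau_i]. *)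
Definition combination := seq (k * btree V).

Definition Lin (r : combination) : {fset nat} :=
  [fset i in flatten [seq leaves p.2 | p <- r]]%fset.

Definition locally_homogeneous (B : V -> Prop) (T : btree unit -> Prop)
    (r : combination) : Prop :=
  [/\ uniq [seq p.2 | p <- r],
      forall p, p \in r ->
        [/\ decorated_in B p.2, T (tree_shape p.2) & well_labelled p.2]
    & forall p, p \in r -> leafset p.2 = Lin r].

Definition relset := combination -> Prop.

Inductive relations (P : operad) (g : V -> P bool) (R : relset) : opset P :=
| Relations r : R r -> relations g R (comb_at g (Lin r) r).

Definition smodule_V : smodule12 := SModule12 'rV[k]_0 V.

(* [P = T(V)/(R)] *)
Definition bin_operad (R : relset) : operad :=
  quotient_operad (generated_ideal (relations (interp2 (gens smodule_V)) R)).

Definition bin_op (R : relset) (w : V) : bin_operad R bool :=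
  omor (quo_proj _) (interp2 (gens smodule_V) w).

End Relations.

(** * The triplicator *)

Inductive tri_symbol := Dashv | Vdash | Perp.

Definition tri_code (u : tri_symbol) : option bool :=
  match u with Dashv => Some true | Vdash => Some false | Perp => None end.
Definition tri_decode (o : option bool) : tri_symbol :=
  match o with Some true => Dashv | Some false => Vdash | None => Perp end.
Lemma tri_codeK : cancel tri_code tri_decode.
Proof. by case. Qed.
HB.instance Definition _ := Finite.copy tri_symbol (can_type tri_codeK).

Definition tri_flip (u : tri_symbol) : tri_symbol :=
  match u with Dashv => Vdash | Vdash => Dashv | Perp => Perp end.

Section Triplicator.
Variable V : s2module.

(* [V (x) (k Dashv (+) k Vdash (+) k Perp)], as the functions from symbols
   to [V]. *)
Definition tri_mod : lmodType k := {ffun tri_symbol -> V}.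

Definition tens (w : V) (u : tri_symbol) : tri_mod :=
  [ffun u' => if u' == u then w else 0].

Definition tri_act (f : tri_mod) : tri_mod :=
  [ffun u => s2act (f (tri_flip u))].

Lemma tri_act_linear : linear tri_act.
Proof. by move=> c f g; apply/ffunP => u; rewrite !ffunE s2act_linear. Qed.

Lemma tri_actK : involutive tri_act.
Proof. by move=> f; apply/ffunP => u; rewrite !ffunE s2actK; case: u. Qed.

Definition Tri : s2module := S2Module tri_act_linear tri_actK.

Lemma tri_act_tens (w : V) (u : tri_symbol) :
  tri_act (tens w u) = tens (s2act w) (tri_flip u).
Proof.
have s0 : s2act (0 : V) = 0.
  by rewrite -[0 in LHS](subrr (0 : V)) (linB _ _ (@s2act_linear V)) subrr.
by apply/ffunP => u'; rewrite !ffunE; case: u u' => -[].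
Qed.

Definition meets (J : {fset nat}) (t : btree V) : bool :=
  has (fun i => i \in J) (leaves t).

(* The symbols allowed at a vertex, according to whether some leaf of [J] is
   reached by turning left, resp. right, at it. *)
Definition allowed (turn_left turn_right : bool) (u : tri_symbol) : Prop :=
  match turn_left, turn_right with
  | true, false => u = Dashv
  | false, true => u = Vdash
  | true, true => u = Perp
  | false, false => True
  end.

Inductive Tri_tree (J : {fset nat}) : btree V -> btree Tri -> Prop :=
| Tri_leaf i : Tri_tree J (Leaf i) (Leaf i)
| Tri_node w u l r l' r' : allowed (meets J l) (meets J r) u ->
    Tri_tree J l l' -> Tri_tree J r r' ->
    Tri_tree J (Node w l r) (Node (tens w u : Tri) l' r').

Definition Tri_comb (J : {fset nat}) (r : combination V) (r' : combination Tri)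
  : Prop :=
  List.Forall2 (fun p p' => p'.1 = p.1 /\ Tri_tree J p.2 p'.2) r r'.

Definition Tri_relset (R : relset V) : relset Tri := fun r' =>
  exists (r : combination V) (J : {fset nat}),
    [/\ R r, J != fset0, (J `<=` Lin r)%fset & Tri_comb J r r'].

Definition Tri_operad (R : relset V) : operad := bin_operad (Tri_relset R).

Definition Tri_op (R : relset V) (w : V) (u : tri_symbol) :
  Tri_operad R bool := bin_op (Tri_relset R) (tens w u : Tri).

End Triplicator.

(** * Tri-average operators of weight one *)

Section TriAverage.
Variable V : s2module.

(* The symbol [P] is the basis vector [1] of [k^o]. *)
Definition smodule_VP : smodule12 := SModule12 k^o V.

Definition TP : operad := free_operad smodule_VP.
Definition symbP : TP unit := interp1 (gens smodule_VP) (1 : k^o).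
Definition symb2 (w : V) : TP bool := interp2 (gens smodule_VP) w.

Inductive TA_relations : opset TP :=
| TA_left w : TA_relations
    (comp11 (symb2 w) symbP symbP - comp1 symbP (comp11 (symb2 w) symbP op_id))
| TA_right w : TA_relations
    (comp11 (symb2 w) symbP symbP - comp1 symbP (comp11 (symb2 w) op_id symbP))
| TA_both w : TA_relations
    (comp11 (symb2 w) symbP symbP - comp1 symbP (symb2 w)).

Definition TA_ideal (R : relset V) : ideal TP :=
  generated_ideal (fun A x => relations symb2 R x \/ TA_relations x).

Definition TA_operad (R : relset V) : operad := quotient_operad (TA_ideal R).

Definition TA_op (R : relset V) (w : V) : TA_operad R bool :=
  omor (quo_proj _) (symb2 w).
Definition TA_P (R : relset V) : TA_operad R unit := omor (quo_proj _) symbP.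

Definition tri_average (R : relset V) (M : lmodType k)
    (rho : algebra (bin_operad R) M) (F : {linear M -> M}) : Prop :=
  forall (w : V) (x y : M), let m := act2 rho (bin_op R w) in
    [/\ F (m x (F y)) = m (F x) (F y),
        m (F x) (F y) = F (m (F x) y)
      & m (F x) (F y) = F (m x y)].

End TriAverage.
End Operads.

(* Main.v *)
(** Write [p] for the operator. An input is called live when it belongs to [J].
   By induction on the tree, the three average identities give: for a tree [t']
   of [Tri_J(t)], the image of [t'] under [eta] (composed with [p] at the root
   if no leaf of [t] is live) is [t] with [p] grafted on every leaf that is not
   live. On operations with a fixed set of inputs this grafting is a linear map
   independent of the tree, so [eta] sends the elements of [Tri_J(r)] to the
   image of [r = 0], which is (a). For (b), a tri-average operator on an algebra
   [M] is a morphism from [TA(P)] to the endomorphism operad of [M]; compose it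
   with (a). *)
From HB Require Import structures.
From mathcomp Require Import finmap boolp functions.
From mathcomp Require Import all_boot all_order all_algebra.
Require Import Defs.

Set Implicit Arguments.
Unset Strict Implicit.
Unset Printing Implicit Defensive.

Import GRing.Theory.
Local Open Scope ring_scope.

(** * Linear maps between modules *)

Lemma linear_comp (k : fieldType) (U V W : lmodType k) (f : V -> W)
    (g : U -> V) :
  linear f -> linear g -> linear (f \o g).
Proof. by move=> lf lg c x y /=; rewrite lg lf. Qed.

Lemma linear_at0 (k : fieldType) (U W : lmodType k) (f : U -> W) :
  linear f -> f 0 = 0.
Proof. by move=> lf; rewrite -[0 in LHS](subrr 0) (linB _ _ lf) subrr. Qed.

Lemma linear_sum_seq (k : fieldType) (U W : lmodType k) (f : U -> W)
    (I : Type) (s : seq I) (c : I -> k) (x : I -> U) : linear f ->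
  f (\sum_(i <- s) c i *: x i) = \sum_(i <- s) c i *: f (x i).
Proof.
move=> lf; elim: s => [|i s IH]; first by rewrite !big_nil linear_at0.
by rewrite !big_cons lf IH.
Qed.

(** * Inverses of bijections and removal of one input *)

Section Bijections.
Variables A B : FSet.

Lemma bij_inv_ex (f : bij A B) :
  exists g : bij B A, bij_cmp g f = bij_id A /\ bij_cmp f g = bij_id B.
Proof.
case: (bijP f) => g fK gK; exists (mkbij gK fK).
by split; apply: bij_ext => x /=; rewrite ?fK ?gK.
Qed.

(** A [bij] holds its inverse only under an existential in [Prop], hence the choice by [cid]. *)
Definition bij_inv (f : bij A B) : bij B A := projT1 (cid (bij_inv_ex f)).

Lemma bij_invl (f : bij A B) : bij_cmp (bij_inv f) f = bij_id A.
Proof. by rewrite /bij_inv; case: cid => g []. Qed.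

Lemma bij_invr (f : bij A B) : bij_cmp f (bij_inv f) = bij_id B.
Proof. by rewrite /bij_inv; case: cid => g []. Qed.

Lemma bij_invK (f : bij A B) : cancel f (bij_inv f).
Proof. by move=> x; have := congr1 (@bfun _ _ ^~ x) (bij_invl f). Qed.

End Bijections.

(** Applied to two ways of splitting the same point off a set, it shows that they differ by a
    bijection of the complements; this makes [plug] below independent of the splitting. *)
Lemma bij_option_inv (A B : FSet) (u : bij (option A) (option B)) :
  u None = None -> exists g : bij A B, u = bij_option g.
Proof.
move=> u0; pose v := bij_inv u.
have uK : cancel u v := bij_invK u.
have vK : cancel v u by move=> x; have := congr1 (@bfun _ _ ^~ x) (bij_invr u).
have v0 : v None = None by rewrite -u0 uK.
have uS x : exists y, u (Some x) = Some y.
  by case E: (u (Some x)) => [y|]; [exists y|move: (uK (Some x)); rewrite E v0].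
have vS y : exists x, v (Some y) = Some x.
  by case E: (v (Some y)) => [x|]; [exists x|move: (vK (Some y)); rewrite E u0].
have [g gE] := choice uS; have [h hE] := choice vS.
have gK : cancel g h.
  by move=> x; apply: Some_inj; rewrite -hE -gE uK.
have hK : cancel h g.
  by move=> x; apply: Some_inj; rewrite -gE -hE vK.
by exists (mkbij gK hK); apply: bij_ext => -[x|] /=; rewrite ?gE.
Qed.

Section Others.
Variables (A : FSet) (a : A).

(** Equality of inputs is decided classically: the enumeration of [A] is filtered by [pselect], and
    proof irrelevance identifies the proofs of [b <> a]. *)
Lemma others_fin : exists s : seq {b : A | b <> a}, forall x, List.In x s.
Proof.
case: (finP A) => s sP.
exists (pmap (fun b => if pselect (b <> a) is left h
                       then Some (exist _ b h) else None) s) => -[b ba].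
elim: s {sP} (sP b) => //= c s IH [->|/IH h] /=; last first.
  by case: pselect => //; right.
case: pselect => // ca; left; congr exist; exact: Prop_irrelevance.
Qed.

Definition others : FSet := MkFSet others_fin.

Lemma bij_others : exists f : bij A (option others), f a = None.
Proof.
pose f (b : A) : option others :=
  if pselect (b <> a) is left h then Some (exist _ b h) else None.
pose g (o : option others) : A := if o is Some x then sval x else a.
have fK : cancel f g by move=> b; rewrite /f; case: pselect => //= /contrapT.
have gK : cancel g f.
  move=> [[b ba]|] /=; rewrite /f; case: pselect => // ba'.
  by congr (Some (exist _ _ _)); exact: Prop_irrelevance.
by exists (mkbij fK gK); rewrite /= /f; case: pselect.
Qed.

End Others.

(** * Associativity of unary and binary composites; grafting on one input *)

Section OperadIdentities.
Variables (k : fieldType) (P : operad k).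
Implicit Types A B C : FSet.

Lemma relabK A B (f : bij A B) : cancel (@relab k P A B f) (relab (bij_inv f)).
Proof. by move=> x; rewrite -relab_comp bij_invl relab_id. Qed.

Lemma relab_inj A B (f : bij A B) : injective (@relab k P A B f).
Proof. exact: can_inj (relabK f). Qed.

Lemma pcomp_relabl A A' B (f : bij A A') (x : P (option A)) (y : P B) :
  pcomp (relab (bij_option f) x) y
  = relab (bij_sum f (bij_id B)) (pcomp x y).
Proof. by rewrite -comp_relab relab_id. Qed.

Lemma pcomp_relabr A B B' (g : bij B B') (x : P (option A)) (y : P B) :
  pcomp x (relab g y) = relab (bij_sum (bij_id A) g) (pcomp x y).
Proof.
rewrite -comp_relab; congr pcomp; rewrite -[LHS]relab_id.
by congr relab; apply: bij_ext => -[].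
Qed.

Lemma comp2_relab A A' B B' (f : bij A A') (g : bij B B') (w : P bool)
  (x : P A) (y : P B) :
  comp2 w (relab f x) (relab g y) = relab (bij_sum f g) (comp2 w x y).
Proof.
rewrite /comp2 -comp_relab (pcomp_relabr f) -!relab_comp.
by congr pcomp; congr relab; apply: bij_ext => -[[]|].
Qed.

Definition inl_void A : bij A (A + void)%type.
Proof.
exists inl; exists (fun x : (A + void)%type => match x with
  inl a => a | inr v => match v with end end) => //; by case=> [|[]].
Defined.

Definition inr_void A : bij A (void + A)%type.
Proof. by exists inr; exists (bij_void_sum A) => //; case=> [[]|]. Defined.

Definition sumC A B : bij (A + B)%type (B + A)%type.
Proof.
exists (fun x => match x with inl a => inr a | inr b => inl b end).
by exists (fun x => match x with inl a => inr a | inr b => inl b end) => -[].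
Defined.

(** [comp2] fills the input [false] before the input [true]; the parallel axiom [comp_par] gives the
    other order. *)
Lemma comp2C A B (w : P bool) (x : P A) (y : P B) :
  comp2 (relab bij_negb w) x y = relab (sumC B A) (comp2 w y x).
Proof.
(* [comp_par] asks for two distinguished inputs, so [bool] is read as [option (option void)]. *)
pose b := bij_cmp (bij_option bij_unit_void) bij_bool_option.
have comp2E C D (v : P bool) (c : P C) (d : P D) : comp2 v c d
    = relab (bij_sum (bij_void_sum C) (bij_id D))
        (pcomp (relab (bij_option_sum void C) (pcomp (relab b v) c)) d).
  rewrite -pcomp_relabl relab_comp (pcomp_relabl bij_unit_void) -!relab_comp.
  by congr pcomp; congr relab; apply: bij_ext => -[[]|].
rewrite !comp2E comp_par -!relab_comp.
(* The swap coming from [comp_par] cancels the negation of the input. *)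
have -> : bij_cmp (bij_cmp (bij_option_swap void) b) bij_negb = b.
  by apply: bij_ext => -[].
by congr relab; apply: bij_ext => -[[[]|]|].
Qed.

Lemma comp2_pcompr A B C (w : P bool) (x : P A) (y : P (option B)) (z : P C) :
  comp2 w x (pcomp y z)
  = relab (bij_sumA A B C) (pcomp (relab (bij_sum_option A B) (comp2 w x y)) z).
Proof. by rewrite /comp2 comp_seq. Qed.

(** [comp2C] reduces this to [comp2_pcompr], where the composite argument is the last one filled and
    [comp_seq] applies directly. *)
Lemma comp2_pcompl A B C (w : P bool) (x : P (option A)) (y : P B) (z : P C) :
  comp2 w (pcomp x z) y
  = relab (bij_sumAC A C B)
      (pcomp (relab (bij_option_sum A B) (comp2 w x y)) z).
Proof.
have wE : w = relab bij_negb (relab bij_negb w).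
  rewrite -relab_comp -[LHS]relab_id; congr relab; apply: bij_ext => -[] //=.
rewrite wE; move: (relab bij_negb w) => {wE} v.
rewrite !comp2C comp2_pcompr -!relab_comp.
have -> : bij_cmp (bij_option_sum A B) (sumC B (option A))
    = bij_cmp (bij_option (sumC B A)) (bij_sum_option B A).
  by apply: bij_ext => -[|[]].
rewrite [in RHS]relab_comp pcomp_relabl -relab_comp.
by congr relab; apply: bij_ext => -[[]|].
Qed.

(** By [comp2_pcompr] and [comp2_pcompl], [y] and then [x] are pulled to the outside, which leaves
    [comp2 w p q]; the rest compares relabellings. *)
Lemma comp2_comp11 A B (w : P bool) (p q : P unit) (x : P A) (y : P B) :
  comp2 (comp11 w p q) x y = comp2 w (comp1 p x) (comp1 q y).
Proof.
rewrite /comp1 comp2_relab comp2_pcompr comp2_pcompl comp2_relab.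
rewrite /comp11 [LHS]/comp2 -!relab_comp.
(* [g] and [n] place the remaining inputs beside the empty summands that filled unary operations
   leave. *)
pose g := bij_cmp (inr_void (option void)) bij_unit_void.
pose n := bij_cmp (inl_void (void + A)%type) (inr_void A).
have -> : bij_cmp (bij_option_sum void (option void))
                  (bij_sum bij_unit_void bij_unit_void)
    = bij_cmp (bij_option g) (bij_cmp bij_bool_option bij_unit2_bool).
  by apply: bij_ext => -[[]|[]].
rewrite [relab (bij_cmp (bij_option g) _) _]relab_comp pcomp_relabl.
rewrite -!relab_comp.
rewrite (_ : bij_cmp _ (bij_sum g _)
    = bij_cmp (bij_option n) (bij_unit_sum A)).
  rewrite [relab (bij_cmp (bij_option n) _) _]relab_comp pcomp_relabl.
  rewrite -!relab_comp -[LHS]relab_id.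
  by congr relab; apply: bij_ext => -[].
by apply: bij_ext => -[[]|].
Qed.

(** [comp_seq] is applied twice, once for each argument grafted into [w]; the rest matches
    relabellings. *)
Lemma comp1_comp2 A B (w : P bool) (p : P unit) (x : P A) (y : P B) :
  comp1 p (comp2 w x y) = comp2 (comp1 p w) x y.
Proof.
rewrite /comp1 /comp2 -comp_seq pcomp_relabr -comp_seq.
rewrite pcomp_relabr -!relab_comp.
have -> : bij_cmp bij_bool_option (bij_void_sum bool) =
    bij_cmp (bij_option (bij_void_sum unit)) (bij_cmp (bij_sum_option void unit)
              (bij_sum (bij_id void) bij_bool_option)).
  by apply: bij_ext => -[[]|[]].
rewrite [relab (bij_cmp (bij_option (bij_void_sum unit)) _) _]relab_comp.
rewrite pcomp_relabl -!relab_comp.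
have -> : bij_cmp (bij_unit_sum A) (bij_sum (bij_void_sum unit) (bij_id A))
    = bij_cmp (bij_option (bij_void_sum A))
        (bij_cmp (bij_cmp (bij_sum_option void A)
                          (bij_sum (bij_id void) (bij_unit_sum A)))
                 (bij_sumA void unit A)).
  by apply: bij_ext => -[[[]|[]]|].
rewrite [relab (bij_cmp (bij_option (bij_void_sum A)) _) _]relab_comp.
by rewrite pcomp_relabl; congr relab; apply: bij_ext => -[[[]|]|].
Qed.

Lemma comp1_id A (x : P A) : comp1 (op_id P) x = x.
Proof. exact: comp_idl. Qed.

Lemma comp1_op_id (p : P unit) : comp1 p (op_id P) = p.
Proof.
rewrite /comp1.
apply: (@relab_inj _ _ bij_unit_void); rewrite -[RHS]comp_idr -relab_comp.
by congr relab; apply: bij_ext => -[[]|[]].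
Qed.

Lemma relabVK A B (f : bij A B) : cancel (relab (bij_inv f)) (@relab k P A B f).
Proof. by move=> x; rewrite -relab_comp bij_invr relab_id. Qed.

Definition plug_last A (p : P unit) (x : P (option A)) : P (option A) :=
  relab (bij_sum_unit A) (pcomp x p).

Lemma plug_last_relab A B (g : bij A B) (p : P unit) (x : P (option A)) :
  plug_last p (relab (bij_option g) x) = relab (bij_option g) (plug_last p x).
Proof.
rewrite /plug_last pcomp_relabl -!relab_comp.
by congr relab; apply: bij_ext => -[].
Qed.

(* The splitting of [A] used here is an arbitrary choice, see [plugP]. *)
Definition plug A (p : P unit) (a : A) (x : P A) : P A :=
  let f := projT1 (cid (bij_others a)) in
  relab (bij_inv f) (plug_last p (relab f x)).

(** Two splittings at [a] differ by a bijection fixing [None] ([bij_option_inv]), and [plug_last]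
    commutes with it; so any splitting computes [plug]. *)
Lemma plugP A A' (f : bij A (option A')) (p : P unit) (a : A) (x : P A) :
  f a = None -> relab f (plug p a x) = plug_last p (relab f x).
Proof.
rewrite /plug; case: cid => f0 /= f0a fa.
have f0K : bij_inv f0 None = a by rewrite -f0a bij_invK.
have [|g gE] := @bij_option_inv _ _ (bij_cmp f (bij_inv f0)).
  by rewrite /= f0K.
have -> : f = bij_cmp (bij_option g) f0.
  by rewrite -gE; apply: bij_ext => b /=; rewrite bij_invK.
by rewrite !relab_comp relabVK plug_last_relab.
Qed.

Lemma plug_linear A (p : P unit) (a : A) : linear (plug p a).
Proof.
by move=> c x y; rewrite /plug /plug_last !(relab_linear, comp_linearl).
Qed.

Lemma plug_relab A B (f : bij A B) (p : P unit) (a : A) (x : P A) :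
  plug p (f a) (relab f x) = relab f (plug p a x).
Proof.
have [g ga] := bij_others (f a).
apply: (@relab_inj _ _ g); rewrite (plugP p _ ga).
by rewrite -[RHS]relab_comp (@plugP _ _ (bij_cmp g f)) // relab_comp.
Qed.

Lemma plug_op_id (p : P unit) : plug p tt (op_id P) = p.
Proof.
apply: (@relab_inj _ _ bij_unit_void); rewrite plugP // /plug_last.
rewrite -[in RHS](comp1_id p) /comp1 -relab_comp.
by congr relab; apply: bij_ext => -[[]|[]].
Qed.

(** By [plugP] the splitting may be chosen to affect the summand [B] alone; what remains is the
    associativity [comp2_pcompr]. *)
Lemma plug_comp2r A B (w : P bool) (x : P A) (y : P B) (p : P unit) (b : B) :
  plug p (inr b : A + B) (comp2 w x y) = comp2 w x (plug p b y).
Proof.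
have [f fb] := bij_others b.
pose h := bij_cmp (bij_sum_option A (others b)) (bij_sum (bij_id A) f).
apply: (@relab_inj _ _ h); rewrite plugP /=; last by rewrite fb.
rewrite /h !relab_comp -!comp2_relab relab_id (plugP p _ fb) /plug_last.
rewrite -{2}[x]relab_id comp2_relab comp2_pcompr -!relab_comp.
by congr relab; apply: bij_ext => -[[|]|[]].
Qed.

Lemma plug_comp2l A B (w : P bool) (x : P A) (y : P B) (p : P unit) (a : A) :
  plug p (inl a : A + B) (comp2 w x y) = comp2 w (plug p a x) y.
Proof.
have [f fa] := bij_others a.
pose h := bij_cmp (bij_option_sum (others a) B) (bij_sum f (bij_id B)).
apply: (@relab_inj _ _ h); rewrite plugP /=; last by rewrite fa.
rewrite /h !relab_comp -!comp2_relab relab_id (plugP p _ fa) /plug_last.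
rewrite -{2}[y]relab_id comp2_relab comp2_pcompl -!relab_comp.
by congr relab; apply: bij_ext => -[[|]|[]].
Qed.

End OperadIdentities.

(** * Trees with a unary operation grafted on each leaf *)

Section DecoratedLeaves.
Variables (k : fieldType) (P : operad k) (D : Type) (g : D -> P bool).
Implicit Types (t : btree D) (d : nat -> P unit).

Fixpoint leaf_op d t : P (leafpos t) :=
  match t return P (leafpos t) with
  | Leaf i => d i
  | Node w l r => comp2 (g w) (leaf_op d l) (leaf_op d r)
  end.

Lemma leaf_op_id t : leaf_op (fun=> op_id P) t = tree_op g t.
Proof. by elim: t => //= w l -> r ->. Qed.

Lemma eq_leaf_op d d' t : {in leaves t, d =1 d'} -> leaf_op d t = leaf_op d' t.
Proof.
elim: t => [i|w l IHl r IHr] /= e; first by rewrite e ?mem_head.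
rewrite IHl ?IHr // => i it; apply: e; by rewrite mem_cat it ?orbT.
Qed.

Lemma leaf_label_leaves t (a : leafpos t) : leaf_label a \in leaves t.
Proof. by have := label_in a erefl; rewrite in_fset. Qed.

Definition set_leaf d i (p : P unit) j := if j == i then p else d j.

(** As labels are distinct, changing [d] at one label changes one leaf. That leaf must carry the
    identity, since plugging composes with what is already there. *)
Lemma plug_leaf_op d t (a : leafpos t) (p : P unit) :
  uniq (leaves t) -> d (leaf_label a) = op_id P ->
  plug p a (leaf_op d t) = leaf_op (set_leaf d (leaf_label a) p) t.
Proof.
elim: t a => [i []|w l IHl r IHr a] /=.
  by move=> _ ->; rewrite plug_op_id /set_leaf eqxx.
rewrite cat_uniq => /and3P[ul /hasPn lr ur].
case: a => a da.
- rewrite plug_comp2l IHl //; congr comp2; apply: eq_leaf_op => j jr.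
  rewrite /set_leaf; case: eqP => // ja; move: (lr _ jr).
  by rewrite ja [_ \in _]leaf_label_leaves.
- rewrite plug_comp2r IHr //; congr comp2; apply: eq_leaf_op => j jl.
  rewrite /set_leaf; case: eqP => // ja; move: (lr _ (leaf_label_leaves a)).
  by rewrite -ja [_ \in _]jl.
Qed.

(** The map [f] is an iterated [plug], indexed by labels in [S] and not by positions in a tree. One
    linear map thus serves all trees with label set [S] and can be applied to a linear relation
    between them. *)
Lemma plug_leaves (S : {fset nat}) (p : P unit) (s : seq nat) :
  uniq s -> {subset s <= S} ->
  exists2 f : P (labels S) -> P (labels S), linear f &
    forall t (tS : uniq (leaves t) /\ leafset t = S),
      f (relab (bij_labels tS) (tree_op g t))
      = relab (bij_labels tS)
          (leaf_op (fun i => if i \in s then p else op_id P) t).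
Proof.
elim: s => [_ _|i s IH /= /andP[si us] sS].
  by exists id => // t tS; rewrite -leaf_op_id.
case: IH => // [j js|f lf fE]; first by apply: sS; rewrite inE js orbT.
have iS : i \in S by apply: sS; exact: mem_head.
pose x : labels S := exist _ i iS.
exists (plug p x \o f) => [|t tS].
  by apply: linear_comp => //; exact: plug_linear.
rewrite /= fE.
have [a ai] : exists a : leafpos t, leaf_label a = i.
  by apply: label_surj; move: (iS); rewrite -(proj2 tS) in_fset.
(* The input [x] was fixed by its label before the tree; in [t] it is the position [a]. *)
have -> : x = bij_labels tS a by exact: val_inj.
rewrite plug_relab plug_leaf_op ?ai ?(negPf si) //; last by case: tS.
congr relab; apply: eq_leaf_op => j _; rewrite /set_leaf inE.
by case: (j == i).
Qed.

End DecoratedLeaves.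

(** * The tri-average identities along a tree *)

Section Average.
Variables (k : fieldType) (Q : operad k) (V : s2module k).
Variables (g : V -> Q bool) (p : Q unit).
Hypothesis avgl : forall w,
  comp11 (g w) p p = comp1 p (comp11 (g w) p (op_id Q)).
Hypothesis avgr : forall w,
  comp11 (g w) p p = comp1 p (comp11 (g w) (op_id Q) p).
Hypothesis avg : forall w, comp11 (g w) p p = comp1 p (g w).

Definition eta (w : V) (u : tri_symbol) : Q bool :=
  match u with
  | Dashv => comp11 (g w) (op_id Q) p
  | Vdash => comp11 (g w) p (op_id Q)
  | Perp => g w
  end.

Variable g' : Tri V -> Q bool.
Hypothesis g'E : forall w u, g' (tens w u) = eta w u.

(** What is grafted at a leaf, or at the root of a subtree; a subtree counts as live when [J] meets
    its leaves. *)
Definition live (b : bool) : Q unit := if b then op_id Q else p.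

Lemma comp11_id w : comp11 w (op_id Q) (op_id Q) = w.
Proof.
pose f (A : FSet) (x : option A) := if x is Some a then inl a else inr tt.
have fK (A : FSet) : cancel (f A) (bij_sum_unit A) by case.
have Kf (A : FSet) : cancel (bij_sum_unit A) (f A) by case=> [|[]].
have idE (A : FSet) (x : Q (option A)) :
    pcomp x (op_id Q) = relab (mkbij (fK A) (Kf A)) x.
  rewrite -[in RHS](comp_idr x) -relab_comp -[LHS]relab_id.
  by congr relab; apply: bij_ext => -[|[]].
rewrite /comp11 /comp2 !idE -!relab_comp -[RHS]relab_id.
by congr relab; apply: bij_ext => -[].
Qed.

(** If a branch is live, [allowed] determines [u] and the unit laws suffice. If none is, [u] is
    arbitrary, and the three symbols give exactly the three average identities. *)
Lemma live_eta (bl br : bool) w u : allowed bl br u ->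
  comp1 (live (bl || br)) (eta w u) = comp11 (g w) (live bl) (live br).
Proof.
case: bl br => -[] /=; rewrite ?comp1_id; try by move=> ->.
  by move=> -> /=; rewrite comp11_id.
by case: u => _ /=.
Qed.

(** The factor [live] at the root is what makes the induction pass through subtrees with no live
    leaf: [live_eta] moves it from the root to the two branches. The bijection [f] is there because
    [leafpos t'] and [leafpos t] are distinct types. *)
Lemma Tri_tree_op (J : {fset nat}) t t' : Tri_tree J t t' ->
  exists2 f : bij (leafpos t') (leafpos t),
    forall a, leaf_label (f a) = leaf_label a &
    relab f (comp1 (live (meets J t)) (tree_op g' t'))
    = leaf_op g (fun i => live (i \in J)) t.
Proof.
elim=> [i|w u l r l' r' lr _ [fl flE IHl] _ [fr frE IHr]].
  exists (bij_id unit) => //=.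
  by rewrite relab_id comp1_op_id /meets /= orbF.
exists (bij_sum fl fr) => [[]a //=|/=].
rewrite g'E comp1_comp2 /meets /= has_cat live_eta // comp2_comp11.
by rewrite -comp2_relab IHl IHr.
Qed.

End Average.

(** * Morphisms, kernels and quotients *)

Section Morphisms.
Variables (k : fieldType) (P Q : operad k) (h : operad_morphism P Q).

Lemma omor0 (A : FSet) : omor h (0 : P A) = 0.
Proof. exact: linear_at0 (@omor_linear _ _ _ h A). Qed.

Lemma omor_comp2 (A B : FSet) (w : P bool) (x : P A) (y : P B) :
  omor h (comp2 w x y) = comp2 (omor h w) (omor h x) (omor h y).
Proof. by rewrite /comp2 !(omor_comp, omor_relab). Qed.

Lemma omor_comp1 (A : FSet) (p : P unit) (x : P A) :
  omor h (comp1 p x) = comp1 (omor h p) (omor h x).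
Proof. by rewrite /comp1 !(omor_comp, omor_relab). Qed.

Lemma omor_comp11 (w : P bool) (p q : P unit) :
  omor h (comp11 w p q) = comp11 (omor h w) (omor h p) (omor h q).
Proof. by rewrite /comp11 omor_relab omor_comp2. Qed.

Lemma omor_tree_op (D : Type) (g : D -> P bool) (t : btree D) :
  omor h (tree_op g t) = tree_op (fun w => omor h (g w)) t.
Proof.
elim: t => [i|w l IHl r IHr] /=; first exact: omor_id.
by rewrite omor_comp2 IHl IHr.
Qed.

Lemma omor_comb_at (D : Type) (g : D -> P bool) (S : {fset nat})
    (r : seq (k * btree D)) :
  omor h (comb_at g S r) = comb_at (fun w => omor h (g w)) S r.
Proof.
rewrite /comb_at linear_sum_seq; last exact: omor_linear.
apply: eq_bigr => p _; congr (_ *: _); rewrite /tree_at.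
case: pselect => [tS|_]; last exact: omor0.
by rewrite omor_relab omor_tree_op.
Qed.

Definition omor_compose (S : operad k) (h' : operad_morphism Q S) :
  operad_morphism P S.
Proof.
refine (@OperadMorphism k P S (fun A x => omor h' (omor h x)) _ _ _ _).
- by move=> A c x y; rewrite !omor_linear.
- by move=> A B f x; rewrite !omor_relab.
- by rewrite !omor_id.
- by move=> A B x y; rewrite !omor_comp.
Defined.

Definition ker_ideal : ideal P.
Proof.
refine (@Ideal k P (fun A x => omor h x = 0) _ _ _ _ _).
- exact: omor0.
- by move=> A c x y hx hy; rewrite omor_linear hx hy scaler0 addr0.
- by move=> A B f x hx; rewrite omor_relab hx; exact/linear_at0/relab_linear.
- move=> A B x y hx; rewrite omor_comp hx.
  exact: linear_at0 (comp_linearl _).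
- move=> A B x y hy; rewrite omor_comp hy.
  exact: linear_at0 (comp_linearr _).
Defined.

(** [phi] evaluates [h] on chosen representatives; since [h] kills [I], the choice does not
    matter. *)
Lemma quo_lift (I : ideal P) :
  (forall (A : FSet) (x : P A), I A x -> omor h x = 0) ->
  exists phi : operad_morphism (quotient_operad I) Q,
    forall (A : FSet) (x : P A), omor phi (omor (quo_proj I) x) = omor h x.
Proof.
move=> hI; 
pose phi (A : FSet) (q : quotient_operad I A) : Q A :=
  omor h (repr (q : quo I A)).
have phiE (A : FSet) (x : P A) : phi A (cls I x) = omor h x.
  apply/eqP; rewrite -subr_eq0 /phi -(linB _ _ (@omor_linear _ _ _ h A)).
  by apply/eqP/hI; exact: cls_repr.
unshelve eexists (@OperadMorphism k (quotient_operad I) Q phi _ _ _ _).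
- move=> A c x y; case: (cls_surj x) (cls_surj y) => x' -> [y' ->].
  by rewrite -cls_linear !phiE omor_linear.
- move=> A B f x; case: (cls_surj x) => x' ->.
  by rewrite [relab f _]quo_relabE !phiE omor_relab.
- by rewrite [op_id _]/(cls I (op_id P)) phiE omor_id.
- move=> A B x y; case: (cls_surj x) (cls_surj y) => x' -> [y' ->].
  by rewrite [pcomp _ _]quo_compE !phiE omor_comp.
- exact: phiE.
Qed.

(** Membership in [generated_ideal G] quantifies over all ideals containing [G]; it is instantiated
    at the kernel of [h]. *)
Lemma generated_lift (G : opset P) :
  (forall (A : FSet) (x : P A), G A x -> omor h x = 0) ->
  exists phi : operad_morphism (quotient_operad (generated_ideal G)) Q,
    forall (A : FSet) (x : P A), omor phi (omor (quo_proj _) x) = omor h x.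
Proof. by move=> hG; apply: quo_lift => A x /(_ ker_ideal hG). Qed.

Lemma generated_vanish (G : opset P) (A : FSet) (x : P A) : G A x ->
  omor (quo_proj (generated_ideal G)) x = 0.
Proof.
move=> Gx; apply/clsP; rewrite subr0 => I; exact.
Qed.

End Morphisms.

(** * Universal property and relations of the presented operads *)

Section Lifts.
Variables (k : fieldType) (V : s2module k).

Lemma bin_lift (R : relset V) (Q : operad k) (e : interp (smodule_V V) Q) :
  (forall r, R r -> comb_at (interp2 e) (Lin r) r = 0) ->
  exists phi : operad_morphism (bin_operad R) Q,
    forall w, omor phi (bin_op R w) = interp2 e w.
Proof.
move=> hR.
have [|phi phiE] := @generated_lift _ _ _ (free_lift e)
    (relations (interp2 (gens (smodule_V V))) R).
  move=> A _ [r Rr]; rewrite omor_comb_at -(hR r Rr).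
  by congr (comb_at _ (Lin r) r); apply/funext => w; exact: free_lift_gen2.
by exists phi => w; rewrite phiE free_lift_gen2.
Qed.

Lemma bin_op_relation (R : relset V) r : R r ->
  comb_at (bin_op R) (Lin r) r = 0.
Proof.
by move=> Rr; rewrite -omor_comb_at; apply: generated_vanish; exact: Relations.
Qed.

Lemma TA_op_relation (R : relset V) r : R r ->
  comb_at (TA_op R) (Lin r) r = 0.
Proof.
move=> Rr; rewrite -omor_comb_at; apply: generated_vanish.
by left; exact: Relations.
Qed.

Lemma TA_relation (R : relset V) (A : FSet) (x y : TP V A) :
  TA_relations (x - y) ->
  omor (quo_proj (TA_ideal R)) x = omor (quo_proj (TA_ideal R)) y.
Proof.
move=> Txy; apply/eqP; rewrite -subr_eq0.
rewrite -(linB _ _ (@omor_linear _ _ _ (quo_proj (TA_ideal R)) A)).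
by apply/eqP/generated_vanish; right.
Qed.

(** Projected to the quotient, [TA_relations] supplies the three average hypotheses of
    [Tri_tree_op]. *)
Lemma TA_average (R : relset V) (w : V) :
  let m := TA_op R w in let p := TA_P R in
  [/\ comp11 m p p = comp1 p (comp11 m p (op_id _)),
      comp11 m p p = comp1 p (comp11 m (op_id _) p)
    & comp11 m p p = comp1 p m].
Proof.
split.
- by have := TA_relation R (TA_left w);
    rewrite omor_comp1 !omor_comp11 omor_id.
- by have := TA_relation R (TA_right w);
    rewrite omor_comp1 !omor_comp11 omor_id.
- by have := TA_relation R (TA_both w); rewrite omor_comp1 !omor_comp11.
Qed.

End Lifts.

(** * The map eta on generators *)

Section EtaInterp.
Variables (k : fieldType) (Q : operad k) (V : s2module k).
Variables (g : V -> Q bool) (p : Q unit).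
Hypothesis g_linear : linear g.
Hypothesis g_act : forall w, g (s2act w) = relab bij_negb (g w).

Lemma comp11_linear (q q' : Q unit) : linear (fun w : Q bool => comp11 w q q').
Proof.
by move=> c x y; rewrite /comp11 /comp2 !(relab_linear, comp_linearl).
Qed.

Lemma comp11C (w : Q bool) (q q' : Q unit) :
  comp11 (relab bij_negb w) q q' = relab bij_negb (comp11 w q' q).
Proof.
rewrite /comp11 comp2C -!relab_comp.
by congr relab; apply: bij_ext => -[[]|[]].
Qed.

Lemma eta_linear u : linear (fun w => eta g p w u).
Proof. by case: u => c x y /=; rewrite g_linear ?comp11_linear. Qed.

(** Exchanging the inputs of [comp11] exchanges the two unary operations ([comp11C]), which matches
    [tri_flip]. *)
Lemma eta_act w u :
  eta g p (s2act w) (tri_flip u) = relab bij_negb (eta g p w u).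
Proof. by case: u => /=; rewrite g_act ?comp11C. Qed.

(** The linear extension of [eta] from pure tensors, [f] being the sum of [tens (f u) u] over the
    three symbols. *)
Definition eta_map (f : Tri V) : Q bool :=
  eta g p (f Dashv) Dashv + eta g p (f Vdash) Vdash + eta g p (f Perp) Perp.

Lemma eta_map_linear : linear eta_map.
Proof.
move=> c x y; rewrite /eta_map !ffunE !eta_linear !scalerDr.
by rewrite [RHS]addrACA; congr (_ + _); rewrite addrACA.
Qed.

Lemma eta_map_act f : eta_map (s2act f) = relab bij_negb (eta_map f).
Proof.
have lD (x y : Q bool) :
    relab bij_negb (x + y) = relab bij_negb x + relab bij_negb y.
  by rewrite -[x]scale1r relab_linear !scale1r.
(* The action exchanges the [Dashv] and [Vdash] components, hence the commutation of the first two
   summands. *)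
by rewrite /eta_map !lD -!eta_act !ffunE /= [X in X + _]addrC.
Qed.

Lemma eta_map_tens w u : eta_map (tens w u) = eta g p w u.
Proof.
have eta0 u' : eta g p 0 u' = 0 by exact: linear_at0 (eta_linear u').
by case: u; rewrite /eta_map !ffunE ![_ == _]/= !eta0 ?addr0 ?add0r.
Qed.

(** The generators of arity one form the zero module ['rV[k]_0], hence the zero map on them. *)
Definition eta_interp : interp (smodule_V (Tri V)) Q.
Proof.
refine (@Interp k (smodule_V (Tri V)) Q (fun=> 0) eta_map _ eta_map_linear
  eta_map_act).
by move=> c x y; rewrite scaler0 addr0.
Defined.

End EtaInterp.

(** * Vanishing of the triplicator relations under eta *)

Section EtaRelations.
Variables (k : fieldType) (Q : operad k) (V : s2module k).
Variables (g : V -> Q bool) (p : Q unit).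
Hypothesis avgl : forall w,
  comp11 (g w) p p = comp1 p (comp11 (g w) p (op_id Q)).
Hypothesis avgr : forall w,
  comp11 (g w) p p = comp1 p (comp11 (g w) (op_id Q) p).
Hypothesis avg : forall w, comp11 (g w) p p = comp1 p (g w).
Variable g' : Tri V -> Q bool.
Hypothesis g'E : forall w u, g' (tens w u) = eta g p w u.

Lemma Tri_tree_leaves (J : {fset nat}) (t : btree V) t' :
  Tri_tree J t t' -> leaves t' = leaves t.
Proof. by elim=> //= w u l r l' r' _ _ -> _ ->. Qed.

Lemma Tri_comb_Lin (J : {fset nat}) (r : combination V) r' :
  Tri_comb J r r' -> Lin r' = Lin r.
Proof.
rewrite /Lin => h.
suff -> : [seq leaves q.2 | q <- r'] = [seq leaves q.2 | q <- r] by [].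
by elim: h => //= q q' s s' [_ /Tri_tree_leaves ->] _ ->.
Qed.

(** Since [J] meets [t], the root factor in [Tri_tree_op] is the identity, so the image of [t'] is
    [t] with [p] grafted outside [J]. *)
Lemma tree_at_eta (J S : {fset nat}) (f : Q (labels S) -> Q (labels S)) :
  (forall t (tS : uniq (leaves t) /\ leafset t = S),
    f (relab (bij_labels tS) (tree_op g t)) = relab (bij_labels tS)
      (leaf_op g (fun i => if i \in (S `\` J)%fset then p else op_id Q) t)) ->
  forall t t', uniq (leaves t) /\ leafset t = S -> meets J t ->
    Tri_tree J t t' -> tree_at g' S t' = f (tree_at g S t).
Proof.
move=> fE t t' tS Jt tt'.
have tS' : uniq (leaves t') /\ leafset t' = S.
  by rewrite /leafset (Tri_tree_leaves tt').
rewrite /tree_at; case: pselect => [{}tS'|//]; case: pselect => [{}tS|//].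
have [phi phil] := Tri_tree_op avgl avgr avg g'E tt'.
rewrite Jt comp1_id fE => phiE.
(* [phi] preserves labels. *)
have -> : bij_labels tS' = bij_cmp (bij_labels tS) phi.
  by apply: bij_ext => a; apply: val_inj => /=.
rewrite relab_comp phiE; congr relab; apply: eq_leaf_op => i it.
have iS : i \in S by rewrite -(proj2 tS) in_fset.
by rewrite in_fsetD iS andbT; case: (i \in J).
Qed.

(** A single linear map [f], grafting [p] on all labels outside [J], sends each tree of [r] to the
    image of any tree in its [Tri_J]; applying [f] to the relation [r] gives the relation [r']. *)
Lemma eta_relation (B : V -> Prop) (T : btree unit -> Prop) (R : relset V) :
  (forall r, R r -> locally_homogeneous B T r) ->
  (forall r, R r -> comb_at g (Lin r) r = 0) ->
  forall r', Tri_relset R r' -> comb_at g' (Lin r') r' = 0.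
Proof.
move=> hR gR r' [r [J [Rr J0 JS rr']]].
rewrite (Tri_comb_Lin rr'); have [_ wl rS] := hR r Rr.
have {gR} := gR r Rr.
have {}wl q : q \in r ->
    [/\ uniq (leaves q.2) /\ leafset q.2 = Lin r & meets J q.2].
  move=> qr; have [_ _ /andP[uq _]] := wl q qr; split.
    by split=> //; exact: rS.
  (* Local homogeneity enters here: every tree of [r] has all labels of [Lin r], so the nonempty [J]
     meets each of them. *)
  have [i iJ] := fset0Pn _ J0; apply/hasP; exists i => //.
  by move: (fsubsetP JS i iJ); rewrite -(rS q qr) in_fset.
(* The label set is frozen as [S], because the later induction passes to sublists of [r], whose own
   [Lin] may differ. *)
move: (Lin r) JS wl => S JS wl {rS hR}.
have [||f lf fE] := @plug_leaves _ _ _ g S p (enum_fset (S `\` J)%fset).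
- exact: fset_uniq.
- by move=> i; rewrite in_fsetD => /andP[].
move/(congr1 f); rewrite (linear_at0 lf) /comb_at linear_sum_seq // => f0.
rewrite -[RHS]f0 {f0}.
elim: rr' wl => [|q q' s s' [q1 qq'] _ IH] wl; first by rewrite !big_nil.
rewrite !big_cons q1 IH; last by move=> x xs; apply: wl; rewrite inE xs orbT.
congr (_ *: _ + _); have [qS Jq] := wl q (mem_head _ _).
exact: (tree_at_eta fE qS Jq qq').
Qed.

End EtaRelations.

Lemma symb2_linear (k : fieldType) (V : s2module k) : linear (@symb2 k V).
Proof. exact: (interp2_linear (gens (smodule_VP V))). Qed.

(** [eta_interp] extends to the free operad, and [eta_relation] lets it descend to the triplicator
    through [bin_lift]. *)
Lemma Tri_to_TA (k : fieldType) (V : s2module k) (B : V -> Prop)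
    (T : btree unit -> Prop) (R : relset V) :
  (forall r, R r -> locally_homogeneous B T r) ->
  exists phi : operad_morphism (Tri_operad R) (TA_operad R),
    forall w u, omor phi (Tri_op R w u) = eta (TA_op R) (TA_P R) w u.
Proof.
move=> hR.
have gl : linear (TA_op R).
  by move=> c x y; rewrite /TA_op symb2_linear omor_linear.
have ga w : TA_op R (s2act w) = relab bij_negb (TA_op R w).
  rewrite /TA_op -omor_relab; congr omor.
  exact: (interp2_act (gens (smodule_VP V))).
have [|phi phiE] := @bin_lift _ (Tri V) (Tri_relset R) _
    (eta_interp (TA_P R) gl ga).
  apply: (eta_relation (p := TA_P R) _ _ _ _ hR (@TA_op_relation _ _ R)).
  - by move=> w; case: (TA_average R w).
  - by move=> w; case: (TA_average R w).
  - by move=> w; case: (TA_average R w).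
  - by move=> w u; exact: eta_map_tens.
by exists phi => w u; rewrite phiE; exact: eta_map_tens.
Qed.

(** * The endomorphism operad of a module *)

Section Endomorphisms.
Variables (k : fieldType) (M : lmodType k).

(** Linearity at [i] is stated through three families agreeing off [i], as in [alg_act_multilinear];
    this avoids updating a family at one input. *)
Definition multilinear (A : FSet) (h : (A -> M) -> M) : Prop :=
  forall (i : A) (c : k) (a b d : A -> M),
    (forall j : A, j <> i -> a j = d j /\ b j = d j) ->
    d i = c *: a i + b i -> h d = c *: h a + h b.

Section Module.
Variable A : FSet.

Definition is_multilinear : pred ((A -> M) -> M) :=
  fun h => `[< multilinear h >].

Lemma is_multilinear_submod : submod_closed is_multilinear.
Proof.
split=> [|e h h' /asboolP hm /asboolP hm']; apply/asboolP => i c a b d o di.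
  by rewrite /= scaler0 addr0.
rewrite !fctE /= (hm i c a b d o di) (hm' i c a b d o di).
by rewrite !scalerDr !scalerA [e * c]mulrC addrACA.
Qed.

HB.instance Definition _ :=
  GRing.isSubmodClosed.Build k ((A -> M) -> M) is_multilinear
    is_multilinear_submod.

Definition multi := {h : (A -> M) -> M | is_multilinear h}.
HB.instance Definition _ := gen_eqMixin multi.
HB.instance Definition _ := gen_choiceMixin multi.
HB.instance Definition _ := [isSub of multi for sval].
HB.instance Definition _ := [SubChoice_isSubLmodule of multi by <:].

Definition Multi (h : (A -> M) -> M) (hm : multilinear h) : multi :=
  exist _ h (introT (asboolP _) hm).

Lemma multiP (x : multi) (i : A) (c : k) (a b d : A -> M) :
  (forall j : A, j <> i -> a j = d j /\ b j = d j) ->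
  d i = c *: a i + b i -> val x d = c *: val x a + val x b.
Proof. by case: x => h /= /asboolP hm; exact: hm. Qed.

Lemma multi_ext (x y : multi) : (forall a, val x a = val y a) -> x = y.
Proof. by move=> e; apply: val_inj; exact: funext. Qed.

Lemma multiE c (x y : multi) a : val (c *: x + y) a = c *: val x a + val y a.
Proof. by []. Qed.

End Module.

Lemma relab_multilinear (A B : FSet) (f : bij A B) (x : multi A) :
  multilinear (fun a : B -> M => val x (a \o f)).
Proof.
move=> i c a b d o di; have [f' fK f'K] := bijP f.
apply: (@multiP _ x (f' i) c (a \o f) (b \o f) (d \o f)); last first.
  by rewrite /= f'K.
by move=> j ji; apply: o => fj; apply: ji; rewrite -fj fK.
Qed.

Lemma id_multilinear : multilinear (fun a : unit -> M => a tt).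
Proof. by move=> [] c a b d _. Qed.

Definition graft (A B : FSet) (y : (B -> M) -> M) (a : (A + B)%type -> M)
    (o : option A) : M :=
  if o is Some i then a (inl i) else y (a \o inr).

Lemma pcomp_multilinear (A B : FSet) (x : multi (option A)) (y : multi B) :
  multilinear (fun a : (A + B)%type -> M => val x (graft (val y) a)).
Proof.
move=> [i|i] c a b d o di.
  apply: (@multiP _ x (Some i) c (graft (val y) a) (graft (val y) b)
    (graft (val y) d)) => // -[j|] ji /=.
    by apply: o => -[ij]; apply: ji; rewrite ij.
  (* The families agree off [inl i], so the value grafted at [None] is common to all three. *)
  have e (u : (A + B)%type -> M) :
      (forall j, j <> inl i -> u j = d j) -> u \o inr = d \o inr :> (B -> M).
    by move=> h; apply: funext => j /=; rewrite h.
  by rewrite !e // => j /o[].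
(* For an input of [y], linearity of [y] at [i] feeds linearity of [x] at [None]. *)
apply: (@multiP _ x None c (graft (val y) a) (graft (val y) b)
  (graft (val y) d)) => [[j|] //= _|/=]; first by apply: o.
apply: (@multiP _ y i c (a \o inr) (b \o inr) (d \o inr)) => // j ji /=.
by apply: o => -[ij]; apply: ji.
Qed.

Definition end_operad : operad k.
Proof.
refine (@Operad k (fun A => multi A : lmodType k)
  (fun A B f x => Multi (relab_multilinear f x)) (Multi id_multilinear)
  (fun A B x y => Multi (pcomp_multilinear x y)) _ _ _ _ _ _ _ _ _ _).
- by move=> A B f c x y; apply: multi_ext.
- by move=> A B z c x y; apply: multi_ext.
(* Linearity in the grafted operation is where multilinearity of [z] is used, at its input
   [None]. *)
- move=> A B z c x y; apply: multi_ext => a; rewrite multiE /=.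
  by apply: (@multiP _ z None c (graft (val x) a) (graft (val y) a)) => // -[].
- by move=> A x; apply: multi_ext.
- by move=> A B C g f x; apply: multi_ext.
- move=> A A' B B' f g x y; apply: multi_ext => a /=.
  by congr (val x); apply: funext => -[].
- move=> A x; apply: multi_ext => a /=.
  by congr (val x); apply: funext => -[].
- by move=> A x; apply: multi_ext.
- move=> A B C x y z; apply: multi_ext => a /=.
  congr (val x); apply: funext => -[i|] //=; congr (val y).
  by apply: funext => -[].
- move=> A B C x y z; apply: multi_ext => a /=.
  by congr (val x); apply: funext => -[[i|]|].
Defined.

Definition alg_multi (P : operad k) (rho : algebra P M) (A : FSet) (x : P A) :
  multi A := Multi (@alg_act_multilinear _ _ _ rho A x).

(** Algebra structures on [M] correspond to morphisms into [end_operad]; [end_algebra] gives the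
    converse passage. *)
Definition end_morphism (P : operad k) (rho : algebra P M) :
  operad_morphism P end_operad.
Proof.
refine (@OperadMorphism k P end_operad (alg_multi rho) _ _ _ _).
- by move=> A c x y; apply: multi_ext => a; exact: alg_act_linear.
- by move=> A B f x; apply: multi_ext => a; exact: alg_act_relab.
- by apply: multi_ext => a; exact: alg_act_id.
- by move=> A B x y; apply: multi_ext => a; exact: alg_act_comp.
Defined.

Definition end_algebra (P : operad k) (h : operad_morphism P end_operad) :
  algebra P M.
Proof.
refine (@Algebra k P M (fun A x => val (omor h x : multi A)) _ _ _ _ _).
- by move=> A a c x y; rewrite omor_linear.
- by move=> A x; exact: multiP.
- by move=> A B f x a; rewrite omor_relab.
- by move=> a; rewrite omor_id.
- by move=> A B x y a; rewrite omor_comp.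
Defined.

Definition ev2 (w : end_operad bool) (x y : M) : M :=
  val (w : multi bool) (fun b => if b then y else x).

Definition ev1 (p : end_operad unit) (x : M) : M :=
  val (p : multi unit) (fun=> x).

Lemma ev2_ext (v w : end_operad bool) :
  (forall x y, ev2 v x y = ev2 w x y) -> v = w.
Proof.
move=> e; apply: multi_ext => a; have := e (a false) (a true).
by rewrite /ev2 (_ : (fun b => _) = a) //; apply: funext => -[].
Qed.

Lemma ev2_comp11 (w : end_operad bool) (p q : end_operad unit) x y :
  ev2 (comp11 w p q) x y = ev2 w (ev1 p x) (ev1 q y).
Proof.
rewrite /ev2 /=; congr (val (w : multi bool)); apply: funext => -[] /=;
  congr (val (_ : multi unit)); exact: funext.
Qed.

Lemma ev2_comp1 (w : end_operad bool) (p : end_operad unit) x y :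
  ev2 (comp1 p w) x y = ev1 p (ev2 w x y).
Proof.
by rewrite /ev2 /=; congr (val (p : multi unit)); apply: funext => -[].
Qed.

Lemma ev1_op_id x : ev1 (op_id end_operad) x = x.
Proof. by []. Qed.

Lemma linear_multilinear (F : {linear M -> M}) :
  multilinear (fun a : unit -> M => F (a tt)).
Proof. by move=> [] c a b d _ ->; rewrite linearP. Qed.

Definition end_unary (F : {linear M -> M}) : end_operad unit :=
  Multi (linear_multilinear F).

End Endomorphisms.

(** * Algebras with a tri-average operator *)

Section AverageAlgebra.
Variables (k : fieldType) (V : s2module k) (R : relset V) (M : lmodType k).
Variables (rho : algebra (bin_operad R) M) (F : {linear M -> M}).

Definition average_interp : interp (smodule_VP V) (end_operad M).
Proof.
refine (@Interp k (smodule_VP V) (end_operad M)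
  (* [symbP] is the vector [1] of [k^o], so this linear map sends it to [F]. *)
  (fun c => (c : k) *: end_unary F)
  (fun w => omor (end_morphism rho) (bin_op R w)) _ _ _).
- by move=> c x y; rewrite scalerDl scalerA.
- move=> c x y; rewrite /bin_op (interp2_linear (gens (smodule_V V))).
  by rewrite !omor_linear.
- move=> w; rewrite -omor_relab /bin_op -omor_relab; congr (omor _ (omor _ _)).
  exact: (interp2_act (gens (smodule_V V))).
Defined.

Hypothesis avgF : tri_average rho F.

(** The relations of [R] vanish because [rho] is defined on their quotient; those of [TA_relations]
    vanish by [avgF], checked on pairs of elements through [ev2_ext]. *)
Lemma TA_end : exists h : operad_morphism (TA_operad R) (end_operad M),
  (forall w, omor h (TA_op R w) = omor (end_morphism rho) (bin_op R w)) /\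
  omor h (TA_P R) = end_unary F.
Proof.
have pE : omor (free_lift average_interp) (symbP V) = end_unary F.
  by rewrite free_lift_gen1 /= scale1r.
have wE w : omor (free_lift average_interp) (symb2 w)
    = omor (end_morphism rho) (bin_op R w) by rewrite free_lift_gen2.
have [|h hE] := @generated_lift _ _ _ (free_lift average_interp)
    (fun A x => relations (@symb2 k V) R x \/ TA_relations x).
  move=> A x [[r Rr]|].
    rewrite omor_comb_at.
    rewrite (_ : (fun w => _) = fun w => omor (end_morphism rho) (bin_op R w)).
      by rewrite -omor_comb_at bin_op_relation //; exact: omor0.
    exact: funext.
  case=> w; rewrite (linB _ _ (@omor_linear _ _ _ _ _));
    rewrite ?(omor_comp1, omor_comp11) ?omor_id pE wE;
    apply/eqP; rewrite subr_eq0; apply/eqP/ev2_ext => a b;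
    rewrite ?(ev2_comp1, ev2_comp11) ?ev1_op_id;
    have [avg1 avg2 avg3] := avgF w a b.
  - exact: avg2.
  - exact/esym/avg1.
  - exact: avg3.
by exists h; split=> [w|]; [rewrite -wE|rewrite -pE]; exact: hE.
Qed.

End AverageAlgebra.

Theorem theorem4p8 (k : fieldType) (V : s2module k) (B : V -> Prop)
    (T : btree unit -> Prop) (R : relset V)
    (hB : linear_basis B) (hT : planar_representatives T)
    (hR : forall r, R r -> locally_homogeneous B T r) :
  (exists phi : operad_morphism (Tri_operad R) (TA_operad R),
     forall w : V,
       [/\ omor phi (Tri_op R w Dashv) = comp11 (TA_op R w) (op_id _) (TA_P R),
           omor phi (Tri_op R w Vdash) = comp11 (TA_op R w) (TA_P R) (op_id _)
         & omor phi (Tri_op R w Perp) = TA_op R w])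
  /\
  (forall (A : lmodType k) (rho : algebra (bin_operad R) A)
      (P : {linear A -> A}),
     tri_average rho P ->
     exists sigma : algebra (Tri_operad R) A,
       forall (w : V) (x y : A),
         [/\ act2 sigma (Tri_op R w Dashv) x y = act2 rho (bin_op R w) x (P y),
             act2 sigma (Tri_op R w Vdash) x y = act2 rho (bin_op R w) (P x) y
           & act2 sigma (Tri_op R w Perp) x y = act2 rho (bin_op R w) x y]).
Proof.
have [phi phiE] := Tri_to_TA hR.
split; first by exists phi => w; rewrite !phiE.
move=> A rho P avgP; have [h [hw hp]] := TA_end avgP.
(* The algebra is the composite of the morphism of the first half with the action of the tri-average
   operad on [A], read back from [end_operad]. *)
exists (end_algebra (omor_compose phi h)) => w x y.
have sE u : act2 (end_algebra (omor_compose phi h)) (Tri_op R w u) x y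
    = ev2 (omor h (eta (TA_op R) (TA_P R) w u)) x y by rewrite -phiE.
split; rewrite sE ?omor_comp11 ?omor_id hw ?hp //; exact: ev2_comp11.
Qed.
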